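(* Let $R := \max(1, \mathfrak{L}(\phi_0))$, where $\phi_0$ is the true convex regression function. There exists a positive constant $C$ depending only on the ratio $c_1/c_2$ such that $$\mathbb{E}_{\phi_0} \ell^2(\hat{\phi}_{ls}, \phi_0) \leq C \left(\log \frac{en}{2c_1}\right) \left(\frac{\sigma^2\sqrt{R}}{n}\right)^{4/5}$$ whenever $$n \geq C \left(\log\frac{en}{2c_1}\right)^{5/4}\frac{\sigma^2}{R^2}.$$
   Context: Let $\mathcal{C}$ denote the set of all real-valued convex functions on $[0,1]$. Let $n \ge 2$ and let $x_1 < x_2 < \dots < x_n$ be fixed design points in $[0,1]$ satisfying $c_1 \le n(x_i - x_{i-1}) \le c_2$ for $i = 2, \dots, n$, where $c_1, c_2$ are positive constants. We observe $Y_i = \phi_0(x_i) + \xi_i$, $i=1,\dots,n$, where $\phi_0 \in \mathcal{C}$ is unknown and $\xi_1,\dots,\xi_n$ are independent normal random variables with mean zero and variance $\sigma^2 > 0$. $\mathbb{E}_{\phi_0}$ denotes expectation when the true function is $\phi_0$. The least squares estimator $\hat{\phi}_{ls}$ is any minimizer of $\sum_{i=1}^n (Y_i - \psi(x_i))^2$ over $\psi \in \mathcal{C}$ (its values at $x_1,\dots,x_n$ are uniquely determined). For real functions $\phi,\psi$ on $[0,1]$, $\ell^2(\phi,\psi) := \frac1n\sum_{i=1}^n(\phi(x_i)-\psi(x_i))^2$ and $\ell$ is its nonnegative square root. For $\phi \in \mathcal{C}$, $\mathfrak{L}(\phi) := \inf\{\ell(\phi,\tau) : \tau \text{ is affine on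 } [0,1]\}$. *)

(* Defs.v *)
From HB Require Import structures.
From mathcomp Require Import all_boot all_order all_algebra.
From mathcomp Require Import all_classical all_reals all_analysis.

Set Implicit Arguments.
Unset Strict Implicit.
Unset Printing Implicit Defensive.

Import Order.TTheory GRing.Theory Num.Theory.

Local Open Scope classical_set_scope.
Local Open Scope ring_scope.

(* Real functions on [0, 1] are represented by total functions R -> R, of which
   only the values on [0, 1] are ever used. A convex function may be
   discontinuous at the endpoints 0 and 1. *)
Definition convex01 (R : realType) (f : R -> R) : Prop :=
  convex_function (`[0, 1]%classic : set R) f.

Definition affine01 (R : realType) (f : R -> R) : Prop :=
  exists a b : R, {in `[0, 1], forall t, f t = a + b * t}.

(* x i is the (i + 1)-th design point. *)
Definition design_points (R : realType) (n : nat) (c1 c2 : R)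
    (x : 'I_n -> R) : Prop :=
  [/\ forall i, 0 <= x i <= 1,
      forall i j : 'I_n, (i < j)%N -> x i < x j &
      forall i j : 'I_n, j = i.+1 :> nat ->
        c1 <= n%:R * (x j - x i) <= c2].

Definition sq_loss (R : realType) (n : nat) (x : 'I_n -> R)
    (phi psi : R -> R) : R :=
  n%:R^-1 * \sum_(i < n) (phi (x i) - psi (x i)) ^+ 2.

Definition loss (R : realType) (n : nat) (x : 'I_n -> R)
    (phi psi : R -> R) : R :=
  Num.sqrt (sq_loss x phi psi).

Definition affine_dist (R : realType) (n : nat) (x : 'I_n -> R)
    (phi : R -> R) : R :=
  inf [set loss x phi tau | tau in [set tau | affine01 tau]].

Definition is_convex_lse (R : realType) (n : nat) (x y : 'I_n -> R)
    (phihat : R -> R) : Prop :=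
  convex01 phihat /\
  forall psi : R -> R, convex01 psi ->
    \sum_(i < n) (y i - phihat (x i)) ^+ 2
      <= \sum_(i < n) (y i - psi (x i)) ^+ 2.

Definition mutually_independent (d : measure_display) (T : measurableType d)
    (R : realType) (P : probability T R) (n : nat)
    (xi : 'I_n -> {RV P >-> R}) : Prop :=
  forall (J : {set 'I_n}) (A : 'I_n -> set R),
    (forall i, measurable (A i)) ->
    P (\bigcap_(i in [set` J]) (xi i @^-1` A i)) =
    (\prod_(i in J) P (xi i @^-1` A i))%E.

(* s is the standard deviation, not the variance. *)
Definition normally_distributed (d : measure_display) (T : measurableType d)
    (R : realType) (P : probability T R) (X : {RV P >-> R}) (m s : R) : Prop :=
  forall A : set R, measurable A -> distribution P X A = normal_prob m s A.

(* Main.v *)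
Require Import Defs.
From HB Require Import structures.
From mathcomp Require Import all_boot all_order all_algebra.
From mathcomp Require Import all_classical all_reals all_analysis.
From mathcomp Require Import measurable_realfun zify ring lra.

(** Write [theta i] for the value of the true function at the i-th design
    point, [v] for the difference between the least squares fit and [theta],
    [<a, b>] for the sum of the [a i * b i] over the design points, and [|v|]
    for the Euclidean norm.  Since the true function competes in the least
    squares problem, [|v|^2 <= 2 <xi, v>], and everything is a matter of
    bounding [<xi, v>] for a difference [v] of two convex sequences, pathwise,
    by an explicit polynomial in the noise whose mean can be computed.

    On a block of consecutive points, split the noise into its projection on
    the affine sequences and a residual orthogonal to them.  The first part is
    paid for by [|v|] times the norm of the projection, which has mean square
    of order [sigma^2].  For the residual, one summation by parts leaves the
    slopes of [v] against partial sums of the residual, and by orthogonality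
    only the oscillation of the slopes over the block matters
    ([affine_block]).  If the residual is larger than a fixed threshold, cut
    the block in the middle and start again.  A block of [m] points has a
    residual of order [sigma * m^(3/2)], so a fourth moment bound shows that
    below the scale [nu^2] set by the threshold further cuts are rare, and
    about [m / nu^2] pieces are used ([recursion_block]).  The oscillations of
    the slopes over the pieces add up to at most the oscillation over the
    block, so the total price of the residuals is the threshold times the
    latter.  This replaces a chaining argument and loses no logarithm.

    Slopes of convex sequences are controlled away from the ends: if a convex
    sequence [g] has a slope [dl] at a point with at least [m] points on the
    side where the slope is even larger, then [|g|^2] is at least of order
    [dl^2 * m^3].  Hence the slopes oscillate by at most [O(|g| * m^(-3/2))]
    over a block of [m] points whose distance to both ends is at least of
    order [m] ([slope_range]).  The design points are cut into [O(log n)] such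
    blocks, which double in size from the ends to the middle
    ([controlled_all]).

    With about [y^2] pieces per block the bounds add up, for [O(log n)]
    blocks, to a mean of order [log n * (sigma^2 * y^2 + sigma * y^(-3) * |g|)],
    where [|g|] is of order [sqrt n * R] up to a multiple of [|v|] that is
    absorbed on the left, affine functions being subtracted for free.  The
    choice [sqrt n * R = sigma * y^5] balances the two terms and gives the
    stated rate; the lower bound assumed on [n] says that [y^8] dominates the
    logarithm, which is what the absorption of [|v|] requires
    ([final_arithmetic]). *)

Set Implicit Arguments.
Unset Strict Implicit.
Unset Printing Implicit Defensive.

Import Order.TTheory GRing.Theory Num.Theory.

Local Open Scope classical_set_scope.
Local Open Scope ring_scope.

(** * Integrals of products of independent variables *)

Import HBNNSimple.

(** By monotone convergence an identity between integrals of indicators extends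
    to nonnegative measurable functions.  It serves twice: with a Gaussian
    density as the weight [G], and with a product of other independent factors
    as [G]. *)
Lemma integral_comp_weight d d' (X : measurableType d) (Y : measurableType d')
    (R : realType) (m : {measure set X -> \bar R})
    (nu : {measure set Y -> \bar R}) (g : X -> Y) (G : X -> R) (k : R) :
    measurable_fun setT g -> measurable_fun setT G ->
    (forall x, 0 <= G x) -> 0 <= k ->
    (forall A, measurable A ->
      (\int[m]_x (\1_A (g x) * G x)%:E = k%:E * nu A)%E) ->
  forall f : Y -> R, measurable_fun setT f -> (forall y, 0 <= f y) ->
  (\int[m]_x (f (g x) * G x)%:E = k%:E * \int[nu]_y (f y)%:E)%E.
Proof.
move=> mg mG G0 k0 ind f mf f0.
have mfE : measurable_fun setT (fun y => (f y)%:E : \bar R) by exact/measurable_EFinP.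
have mT : measurable [set: Y] by [].
pose h := nnsfun_approx mT mfE.
have cvh y : ((h n y)%:E @[n --> \oo] --> (f y)%:E)%E.
  by apply: cvg_nnsfun_approx => // x _; rewrite lee_fin.
have -> : (\int[nu]_y (f y)%:E =
    lim (\int[nu]_y (h n y)%:E @[n --> \oo]))%E.
  rewrite -monotone_convergence//.
  - by apply: eq_integral => y _; apply/esym/cvg_lim.
  - by move=> n; exact/measurable_EFinP/measurable_funP.
  - by move=> n y _; rewrite lee_fin.
  - by move=> y _ a b ab; rewrite lee_fin; exact/lefP/nd_nnsfun_approx.
have mhG n : measurable_fun setT (fun x => h n (g x) * G x).
  apply: measurable_funM => //.
  by apply: measurableT_comp => //; exact/measurable_funP.
have -> : (\int[m]_x (f (g x) * G x)%:E =
    lim (\int[m]_x (h n (g x) * G x)%:E @[n --> \oo]))%E.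
  rewrite -monotone_convergence//.
  - apply: eq_integral => x _; apply/esym/cvg_lim => //.
    suff : ((h n (g x))%:E * (G x)%:E @[n --> \oo]
      --> (f (g x))%:E * (G x)%:E)%E by [].
    by apply: cvgeZr => //; exact: cvh.
  - by move=> n; exact/measurable_EFinP.
  - by move=> n x _; rewrite lee_fin mulr_ge0.
  - move=> x _ a b ab; rewrite lee_fin ler_wpM2r//.
    exact/lefP/nd_nnsfun_approx.
have indich n r : measurable_fun setT (fun y => (r * \1_(h n @^-1` [set r]) y)).
  by apply: measurable_funM.
have step n : (\int[m]_x (h n (g x) * G x)%:E = k%:E * \int[nu]_y (h n y)%:E)%E.
  transitivity (\int[nu]_y (\sum_(r \in range (h n))
     (k * (r * \1_(h n @^-1` [set r]) y))%:E))%E; last first.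
    rewrite -ge0_integralZl_EFin//; last 2 first.
    - by move=> y _; rewrite lee_fin.
    - exact/measurable_EFinP/measurable_funP.
    apply: eq_integral => y _; rewrite [in RHS]fimfunE -EFinM.
    by rewrite fsumEFin//; congr EFin; rewrite mulr_fsumr.
  rewrite ge0_integral_fsum//; last 2 first.
  - move=> r; apply/measurable_EFinP; apply: measurable_funM => //.
  - move=> r y _; rewrite lee_fin mulr_ge0//.
    by have := nnfun_muleindic_ge0 (h n) r y; rewrite lee_fin.
  transitivity (\int[m]_x (\sum_(r \in range (h n))
     ((r * \1_(h n @^-1` [set r]) (g x)) * G x)%:E))%E.
    apply: eq_integral => x _; rewrite [in LHS]fimfunE.
    by rewrite fsumEFin//; congr EFin; rewrite mulr_fsuml.
  rewrite ge0_integral_fsum//; last 2 first.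
  - move=> r; apply/measurable_EFinP; apply: measurable_funM => //.
    by apply: measurableT_comp (indich n r) _.
  - move=> r x _; rewrite lee_fin mulr_ge0//.
    by have := nnfun_muleindic_ge0 (h n) r (g x); rewrite lee_fin.
  apply: eq_fsbigr => r rh.
  have r0 : 0 <= r by move: rh; rewrite inE => -[y _ <-].
  have mA : measurable (h n @^-1` [set r]) by [].
  transitivity (r%:E * \int[m]_x (\1_(h n @^-1` [set r]) (g x) * G x)%:E)%E.
    rewrite -ge0_integralZl_EFin//.
    - by apply: eq_integral => x _; rewrite -EFinM mulrA.
    - by move=> x _; rewrite lee_fin mulr_ge0.
    - apply/measurable_EFinP/measurable_funM => //.
      by apply: measurableT_comp.
  rewrite ind//.
  transitivity (r%:E * (k%:E * \int[nu]_y (\1_(h n @^-1` [set r]) y)%:E))%E.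
    by rewrite integral_indic// setIT.
  rewrite -ge0_integralZl_EFin//; last exact/measurable_EFinP.
  rewrite -ge0_integralZl_EFin//; last 2 first.
  - by move=> y _; rewrite mule_ge0 ?lee_fin.
  - by apply/measurable_funeM/measurable_EFinP.
  by apply: eq_integral => y _; rewrite -!EFinM mulrCA.
under eq_fun do rewrite step.
apply/cvg_lim => //; apply: cvgeZl => //.
apply: ereal_nondecreasing_is_cvgn => a b ab.
apply: ge0_le_integral => //.
- by move=> y _; rewrite lee_fin.
- exact/measurable_EFinP/measurable_funP.
- exact/measurable_EFinP/measurable_funP.
- by move=> y _; rewrite lee_fin; exact/lefP/nd_nnsfun_approx.
Qed.

(** The defining suprema compare directly.  The loss of the fitted function,
    which comes from an arbitrary selection of minimizers, is a function [f]
    that may fail to be measurable, and it is bounded in this way. *)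
Lemma le_ge0_integral d (X : measurableType d) (R : realType)
    (m : {measure set X -> \bar R}) (f g : X -> R) :
    (forall x, 0 <= f x) -> (forall x, f x <= g x) ->
  (\int[m]_x (f x)%:E <= \int[m]_x (g x)%:E)%E.
Proof.
move=> f0 fg.
rewrite !ge0_integralTE.
- apply: le_ereal_sup => _ [h hf <-]; exists h => // x.
  by apply: (le_trans (hf x)); rewrite lee_fin.
- by move=> x; rewrite lee_fin (le_trans (f0 x)).
- by move=> x; rewrite lee_fin.
Qed.

(** Completing the square turns [expR (c * x)] times the centred density into a
    multiple of the density centred at [c * s ^+ 2]. *)
Lemma normal_mgf d (T : measurableType d) (R : realType) (P : probability T R)
    (X : {RV P >-> R}) (s c : R) : s != 0 -> normally_distributed X 0 s ->
  (\int[P]_w (expR (c * X w))%:E = (expR (c ^+ 2 * s ^+ 2 / 2))%:E)%E.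
Proof.
move=> s0 nX.
have mexp : measurable_fun setT (fun x : R => expR (c * x)).
  by apply: measurableT_comp => //; exact: measurable_funM.
transitivity (\int[distribution P X]_x (expR (c * x))%:E)%E.
  rewrite ge0_integral_distribution//; exact/measurable_EFinP.
have mnp : measurable_fun setT (fun x : R => (normal_pdf (c * s ^+ 2) s x)%:E).
  by apply/measurable_EFinP; exact: measurable_normal_pdf.
have := @integral_comp_weight _ _ _ _ R lebesgue_measure (distribution P X)
   id (normal_pdf 0 s) 1 _ _ _ _ _ _ mexp.
rewrite mul1e => <- //.
- transitivity (\int[lebesgue_measure]_x ((expR (c ^+ 2 * s ^+ 2 / 2))%:E *
     (normal_pdf (c * s ^+ 2) s x)%:E))%E; last first.
    rewrite ge0_integralZl_EFin ?expR_ge0 ?integral_normal_pdf ?mule1//.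
    + by move=> x _; rewrite lee_fin normal_pdf_ge0.
  apply: eq_integral => x _; rewrite -EFinM; congr EFin.
  rewrite !normal_pdfE// /normal_fun mulrCA [RHS]mulrCA; congr *%R.
  by rewrite -!expRD; congr expR; field.
- exact: measurable_normal_pdf.
- by move=> x; exact: normal_pdf_ge0.
- move=> A mA; rewrite mul1e; apply: etrans (esym (nX _ mA)); rewrite /normal_prob [RHS]integral_mkcond.
  by apply: eq_integral => x _; rewrite patchE indicE mulrC; case: (x \in A);
    rewrite ?mulr1 ?mulr0.
Qed.

Lemma independent_integral_prod d (T : measurableType d) (R : realType)
    (P : probability T R) n (X : 'I_n -> {RV P >-> R}) (f : 'I_n -> R -> R)
    (m : 'I_n -> R) (s : seq 'I_n) :
    mutually_independent X ->
    (forall i, measurable_fun setT (f i)) -> (forall i x, 0 <= f i x) ->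
    (forall i, \int[P]_w (f i (X i w))%:E = (m i)%:E)%E -> uniq s ->
  (\int[P]_w (\prod_(i <- s) f i (X i w))%:E = (\prod_(i <- s) m i)%:E)%E.
Proof.
move=> ind mf f0 fm us.
have m0 i : 0 <= m i by rewrite -lee_fin -fm integral_ge0// => w _; rewrite lee_fin.
(* The factors indexed by [J] are indicators, for which independence gives the
   formula; the induction turns them into general factors one at a time. *)
suff gen (J : {set 'I_n}) (A : 'I_n -> set R) : (forall i, measurable (A i)) ->
    (forall i, i \in s -> i \notin J) ->
    (\int[P]_w (\prod_(i <- s) f i (X i w) * \prod_(i in J) \1_(A i) (X i w))%:E =
     (\prod_(i <- s) m i * \prod_(i in J) fine (P (X i @^-1` A i)))%:E)%E.
  have := gen (finset.set0 : {set 'I_n}) (fun=> setT).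
  rewrite big_set0 mulr1 => <- //; last by move=> i _; rewrite finset.in_set0.
  by apply: eq_integral => w _; rewrite big_set0 mulr1.
elim: s us J A => [_ J A mA _|i s IH /= /andP[nis us] J A mA sJ].
  rewrite !big_nil mul1r.
  transitivity (\int[P]_w (\1_(\bigcap_(i in [set` J]) (X i @^-1` A i)) w)%:E)%E.
    apply: eq_integral => w _; rewrite big_nil mul1r; congr EFin.
    rewrite indicE; have [wA|wA] := boolP (w \in _).
      by rewrite big1// => i iJ; rewrite indicE mem_set//; rewrite inE in wA; exact: wA.
    have [i iJ nA] : exists2 i, i \in J & ~ A i (X i w).
      apply: contrapT => H; move/negP: wA; apply; rewrite inE => i iJ /=.
      by apply: contrapT => nA; apply: H; exists i.
    by rewrite (bigD1 i)//= indicE memNset// mul0r.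
  rewrite integral_indic//; last first.
    apply: fin_bigcap_measurable => //.
    by move=> i _; rewrite -[X in measurable X]setTI; exact: measurable_funPT.
  rewrite setIT -prodEFin; apply: (etrans (ind J A mA)); apply: eq_bigr => i _.
  by rewrite fineK// fin_num_measure// -[X in measurable X]setTI;
     exact: measurable_funPT.
have mprod w : \prod_(j <- i :: s) f j (X j w) = f i (X i w) * \prod_(j <- s) f j (X j w).
  by rewrite big_cons.
under eq_integral do rewrite mprod -mulrA.
have p0 j B : 0 <= fine (P (X j @^-1` B)) by rewrite fine_ge0.
rewrite (@integral_comp_weight _ _ _ _ R P (distribution P (X i)) (X i) _
  (\prod_(j <- s) m j * \prod_(j in J) fine (P (X j @^-1` A j))))//.
- rewrite ge0_integral_distribution//; last 2 first.
    by apply/measurable_EFinP; exact: mf.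
    by move=> y; rewrite lee_fin.
  by rewrite fm big_cons -EFinM mulrC mulrA.
- apply: measurable_funM.
    by apply: measurable_prod => j _; apply: measurableT_comp.
  under eq_fun do rewrite -big_enum/=.
  by apply: measurable_prod => j _; apply: measurableT_comp.

- by move=> w; rewrite mulr_ge0// prodr_ge0.
- by rewrite mulr_ge0// prodr_ge0.
move=> B mB; pose A' j := if j == i then B else A j.
have := IH us (i |: J)%SET A'.
have iJ : i \notin J by apply: sJ; rewrite mem_head.
have A'i : A' i = B by rewrite /A' eqxx.
have A'E (r : 'I_n -> set R -> R) :
    \prod_(j in (i |: J)%SET) r j (A' j) = r i B * \prod_(j in J) r j (A j).
  rewrite big_setU1//= A'i; congr *%R; apply: eq_bigr => j jJ.
  by rewrite /A' ifN//; apply: contraNneq iJ => <-.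
have /= -> := A'E (fun j B => fine (P (X j @^-1` B))).
have E w : \prod_(j in (i |: J)%SET) \1_(A' j) (X j w) =
    \1_B (X i w) * \prod_(j in J) \1_(A j) (X j w) :> R.
  exact: (A'E (fun j B => \1_B (X j w))).
under eq_integral do rewrite E mulrCA.
move=> ->.
- rewrite -[X in (_ = _ * X)%E]fineK//; last first.
    exact: fin_num_measure.
  by rewrite -EFinM; congr EFin; rewrite mulrCA mulrC.
- by move=> j; rewrite /A'; case: ifP.
- move=> j js; rewrite in_setU1 negb_or sJ ?andbT; last by rewrite inE js orbT.
  by apply: contraNneq nis => <-.
Qed.

(** * Moments of linear forms in Gaussian noise *)

(** Measurability, sign and mean travel together, so that the random part of a
    pathwise bound can be assembled along with the bound on its mean. *)
Definition mean_le d (T : measurableType d) (R : realType)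
    (P : probability T R) (f : T -> R) (B : R) :=
  [/\ measurable_fun setT f, forall w, 0 <= f w &
      (\int[P]_w (f w)%:E <= B%:E)%E].

Section mean_le_theory.
Context d (T : measurableType d) (R : realType) (P : probability T R).
Implicit Types (f g : T -> R) (B k : R).

Lemma mean_le_cst k : 0 <= k -> mean_le P (fun=> k) k.
Proof.
move=> k0; split => //.
by rewrite integral_cst//= probability_setT mule1.
Qed.

Lemma mean_le_ext f g B : (forall w, f w = g w) -> mean_le P f B -> mean_le P g B.
Proof. by move=> /funext ->. Qed.

Lemma mean_leW f B B' : B <= B' -> mean_le P f B -> mean_le P f B'.
Proof. by move=> BB [? ? H]; split => //; apply: (le_trans H); rewrite lee_fin. Qed.

Lemma mean_leD f g B B' : mean_le P f B -> mean_le P g B' ->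
  mean_le P (fun w => f w + g w) (B + B').
Proof.
move=> [mf f0 fB] [mg g0 gB]; split.
- exact: measurable_funD.
- by move=> w; rewrite addr_ge0.
under eq_integral do rewrite EFinD.
rewrite ge0_integralD//.
- by rewrite EFinD leeD.
- by move=> w _; rewrite lee_fin.
- exact/measurable_EFinP.
- by move=> w _; rewrite lee_fin.
- exact/measurable_EFinP.
Qed.

Lemma mean_leZ k f B : 0 <= k -> mean_le P f B ->
  mean_le P (fun w => k * f w) (k * B).
Proof.
move=> k0 [mf f0 fB]; split.
- exact: measurable_funM.
- by move=> w; rewrite mulr_ge0.
under eq_integral do rewrite EFinM.
rewrite ge0_integralZl_EFin//.
- by rewrite EFinM; apply: lee_wpmul2l => //; rewrite lee_fin.
- by move=> w _; rewrite lee_fin.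
- exact/measurable_EFinP.
Qed.

Lemma mean_le_sum (F : nat -> T -> R) B a b :
    (forall i, (a <= i < b)%N -> mean_le P (F i) B) ->
  mean_le P (fun w => \sum_(a <= i < b) F i w) ((b - a)%:R * B).
Proof.
elim: b => [_|b IH H].
  rewrite sub0n mul0r; apply: (@mean_leW _ 0) => //.
  by under [X in mean_le _ X _]eq_fun do rewrite big_geq//; exact: mean_le_cst.
have [ab|ba] := leqP a b; last first.
  rewrite (eqP ba) mul0r.
  by under [X in mean_le _ X _]eq_fun do rewrite big_geq//; exact: mean_le_cst.
under [X in mean_le _ X _]eq_fun do rewrite big_nat_recr//.
rewrite subSn// -natr1 mulrDl mul1r; apply: mean_leD.
  by apply: IH => i /andP[ai ib]; apply: H; rewrite ai ltnW.
by apply: H; rewrite ab ltnS leqnn.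
Qed.

Lemma mean_le_dom f g B : measurable_fun setT g -> (forall w, 0 <= g w) ->
  (forall w, g w <= f w) -> mean_le P f B -> mean_le P g B.
Proof.
move=> mg g0 gf [mf f0 fB]; split => //.
by apply: le_trans fB; exact: le_ge0_integral.
Qed.

End mean_le_theory.

(** All that the geometric part of the proof asks of the noise.  An upper bound
    [q] instead of the sum of squares itself avoids a separate treatment of the
    zero form. *)
Definition lform_moment4 d (T : measurableType d) (R : realType)
    (P : probability T R) (n : nat) (s M : R) (Z : nat -> T -> R) :=
  (forall i, measurable_fun setT (Z i)) /\
  forall (c : nat -> R) a b (q : R), (b <= n)%N -> 0 < q ->
    \sum_(a <= i < b) c i ^+ 2 <= q ->
    mean_le P (fun w => (\sum_(a <= i < b) c i * Z i w) ^+ 4)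
      (M * s ^+ 4 * q ^+ 2).

Section moments.
Context d (T : measurableType d) (R : realType) (P : probability T R).

Lemma pow4_le_expR (x : R) : x ^+ 4 <= 256 * (expR x + expR (- x)).
Proof.
have key (y : R) : 0 <= y -> y ^+ 4 <= 256 * expR y.
  move=> y0.
  have e1 : y / 4 <= expR (y / 4).
    by apply: le_trans (expR_ge1Dx _); lra.
  have -> : expR y = expR (y / 4) ^+ 4.
    by rewrite -expRM_natl; congr expR; field.
  have : (y / 4) ^+ 4 <= expR (y / 4) ^+ 4.
    by rewrite lerXn2r// nnegrE ?expR_ge0//; lra.
  rewrite exprMn; lra.
have [x0|x0] := leP 0 x.
  rewrite mulrDr; apply: (le_trans (key x x0)).
  by rewrite lerDl; exact: mulr_ge0 (ler0n _ 256) (expR_ge0 _).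
have -> : x ^+ 4 = (- x) ^+ 4 by ring.
rewrite mulrDr; apply: (le_trans (key (- x) _)); first lra.
by rewrite lerDr; exact: mulr_ge0 (ler0n _ 256) (expR_ge0 _).
Qed.

Lemma independent_normal_mgf n (xi : 'I_n.+1 -> {RV P >-> R}) (s : R)
    (c : nat -> R) a b :
    0 < s -> mutually_independent xi ->
    (forall i, normally_distributed (xi i) 0 s) -> (b <= n.+1)%N ->
  (\int[P]_w (expR (\sum_(a <= i < b) c i * xi (inord i) w))%:E =
   (expR (s ^+ 2 / 2 * \sum_(a <= i < b) c i ^+ 2))%:E)%E.
Proof.
move=> s0 ind nor bn.
pose f (i : 'I_n.+1) x := expR (c i * x).
pose m (i : 'I_n.+1) := expR (c i ^+ 2 * s ^+ 2 / 2).
have mem i : (i \in index_iota a b) -> (inord i : 'I_n.+1) = i :> nat.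
  by rewrite mem_index_iota => /andP[_ ib]; rewrite inordK// (leq_trans ib).
have us : uniq [seq (inord i : 'I_n.+1) | i <- index_iota a b].
  rewrite map_inj_in_uniq ?iota_uniq// => i j iab jab.
  by move=> /(congr1 val) /=; rewrite !mem.
have := @independent_integral_prod _ _ _ P _ xi f m _ ind _ _ _ us.
rewrite big_map => H.
transitivity (\int[P]_w (\prod_(i <- [seq (inord i : 'I_n.+1) | i <- index_iota a b])
   f i (xi i w))%:E)%E.
  apply: eq_integral => w _; rewrite big_map expR_sum; congr EFin.
  by rewrite !big_seq; apply: eq_bigr => i /mem; rewrite /f => ->.
rewrite H.
- rewrite mulr_sumr expR_sum; congr EFin.
  rewrite !big_seq; apply: eq_bigr => i /mem; rewrite /m => ->.
  by congr expR; ring.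
- by move=> i; apply: measurableT_comp => //; exact: measurable_funM.
- by move=> i x; exact: expR_ge0.
- by move=> i; apply: normal_mgf => //; rewrite gt_eqF.
Qed.

(** At [1 / (s * sqrt q)] and its opposite the moment generating function of
    the form is at most [expR 1], and it dominates the fourth power. *)
Lemma normal_lform_moment4 n (xi : 'I_n.+1 -> {RV P >-> R}) (s : R) :
    0 < s -> mutually_independent xi ->
    (forall i, normally_distributed (xi i) 0 s) ->
  lform_moment4 P n.+1 s (512 * expR 1) (fun i => xi (inord i)).
Proof.
move=> s0 ind nor; split => // c a b q bn q0 cq.
pose u := s * Num.sqrt q.
have u0 : 0 < u by rewrite mulr_gt0 ?sqrtr_gt0.
have u4 : u ^+ 4 = s ^+ 4 * q ^+ 2.
  by rewrite /u exprMn (exprM (Num.sqrt q) 2 2) sqr_sqrtr// ltW.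
have mgf e : e ^+ 2 = 1 -> mean_le P
    (fun w => expR (\sum_(a <= i < b) (e / u * c i) * xi (inord i) w)) (expR 1).
  move=> e2; split.
  - apply: measurableT_comp => //; apply: measurable_sum => i.
    exact: measurable_funM.
  - by move=> w; exact: expR_ge0.
  rewrite (@independent_normal_mgf _ _ s (fun i => e / u * c i))// lee_fin ler_expR.
  under eq_bigr do rewrite exprMn.
  rewrite -mulr_sumr exprMn e2 mul1r exprVn /u exprMn sqr_sqrtr; last exact: ltW.
  have -> : s ^+ 2 / 2 * ((s ^+ 2 * q)^-1 * \sum_(a <= i < b) c i ^+ 2) =
    (\sum_(a <= i < b) c i ^+ 2) / q / 2 by field; rewrite !gt_eqF.
  have : (\sum_(a <= i < b) c i ^+ 2) / q <= 1 by rewrite ler_pdivrMr// mul1r.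
  lra.
have := mean_leZ (ltW (exprn_gt0 4 u0)) (mean_leZ (ler0n R 256)
   (mean_leD (mgf 1 _) (mgf (-1) _))).
rewrite expr1n sqrrN expr1n => /(_ erefl erefl).
have mS : measurable_fun setT (fun w => \sum_(a <= i < b) c i * xi (inord i) w).
  by apply: measurable_sum => i; exact: measurable_funM.
move=> H; apply: mean_leW (mean_le_dom _ _ _ H).
- rewrite u4; lra.
- exact: measurable_funX.
- by move=> w; rewrite exprn_even_ge0.
move=> w.
have E e : \sum_(a <= i < b) e / u * c i * xi (inord i) w =
    e * ((\sum_(a <= i < b) c i * xi (inord i) w) / u).
  by rewrite mulr_suml mulr_sumr; apply: eq_bigr => i _; ring.
rewrite !E mul1r mulN1r; set S := \sum_(a <= i < b) _.
have -> : S ^+ 4 = u ^+ 4 * (S / u) ^+ 4 by field; rewrite gt_eqF.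
by rewrite ler_pM2l ?exprn_gt0// pow4_le_expR.
Qed.

Section products.
Variables (n : nat) (s M : R) (Z : nat -> T -> R).
Hypotheses (s0 : 0 < s) (M1 : 1 <= M) (hZ : lform_moment4 P n s M Z).

Lemma measurable_lform (c : nat -> R) a b :
  measurable_fun setT (fun w => \sum_(a <= i < b) c i * Z i w).
Proof. by apply: measurable_sum => i; apply: measurable_funM => //; exact: hZ.1. Qed.

(** The product is below the mean of the two fourth powers, weighted so as to
    make them comparable. *)
Lemma lform_moment22 (c c' : nat -> R) a b a' b' (q q' : R) :
    (b <= n)%N -> (b' <= n)%N -> 0 < q -> 0 < q' ->
    \sum_(a <= i < b) c i ^+ 2 <= q -> \sum_(a' <= i < b') c' i ^+ 2 <= q' ->
  mean_le P (fun w => (\sum_(a <= i < b) c i * Z i w) ^+ 2 *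
                      (\sum_(a' <= i < b') c' i * Z i w) ^+ 2)
    (M * s ^+ 4 * (q * q')).
Proof.
move=> bn bn' q0 q0' cq cq'.
have H := hZ.2 c _ _ _ bn q0 cq; have H' := hZ.2 c' _ _ _ bn' q0' cq'.
have k0 : 0 <= q' / q / 2 by rewrite !divr_ge0// ltW.
have k0' : 0 <= q / q' / 2 by rewrite !divr_ge0// ltW.
apply: mean_leW (mean_le_dom _ _ _ (mean_leD (mean_leZ k0 H) (mean_leZ k0' H'))).
- rewrite le_eqVlt; apply/orP; left; apply/eqP; field; by rewrite !gt_eqF.
- by apply: measurable_funM; apply: measurable_funX; exact: measurable_lform.
- by move=> w; rewrite mulr_ge0 ?sqr_ge0.
move=> w; set A := \sum_(a <= i < b) _; set A' := \sum_(a' <= i < b') _.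
rewrite -subr_ge0.
have -> : q' / q / 2 * A ^+ 4 + q / q' / 2 * A' ^+ 4 - A ^+ 2 * A' ^+ 2 =
  (q' * A ^+ 2 - q * A' ^+ 2) ^+ 2 / (2 * q * q') by field; rewrite !gt_eqF.
by rewrite divr_ge0 ?sqr_ge0// !mulr_ge0// ltW.
Qed.

Lemma lform_moment2 (c : nat -> R) a b (q : R) :
    (b <= n)%N -> 0 < q -> \sum_(a <= i < b) c i ^+ 2 <= q ->
  mean_le P (fun w => (\sum_(a <= i < b) c i * Z i w) ^+ 2) (M * s ^+ 2 * q).
Proof.
move=> bn q0 cq.
have H := hZ.2 c _ _ _ bn q0 cq.
have u0 : 0 < s ^+ 2 * q by rewrite mulr_gt0 ?exprn_gt0.
have k0 : 0 <= (2 * (s ^+ 2 * q))^-1 by rewrite invr_ge0 mulr_ge0// ltW.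
have v0 : 0 <= s ^+ 2 * q / 2 by rewrite divr_ge0// ltW.
apply: mean_leW (mean_le_dom _ _ _ (mean_leD (mean_leZ k0 H) (mean_le_cst P v0))).
- have -> : (2 * (s ^+ 2 * q))^-1 * (M * s ^+ 4 * q ^+ 2) + s ^+ 2 * q / 2 =
    (M + 1) / 2 * (s ^+ 2 * q) by field; rewrite !gt_eqF.
  by rewrite -[leRHS]mulrA ler_pM2r// ler_pdivrMr// mulr_natr mulr2n lerD2l.
- by apply: measurable_funX; exact: measurable_lform.
- by move=> w; rewrite sqr_ge0.
move=> w; set A := \sum_(a <= i < b) _; rewrite -subr_ge0.
have -> : (2 * (s ^+ 2 * q))^-1 * A ^+ 4 + s ^+ 2 * q / 2 - A ^+ 2 =
  (A ^+ 2 - s ^+ 2 * q) ^+ 2 / (2 * (s ^+ 2 * q)) by field; rewrite !gt_eqF.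
by rewrite divr_ge0 ?sqr_ge0// mulr_ge0// ltW.
Qed.

End products.
End moments.

(** * Sums over intervals of integers *)

Section sums.
Context (R : realType).
Implicit Types (f g : nat -> R) (a b : nat).

Lemma sum_sqr_ge0 f a b : 0 <= \sum_(a <= i < b) f i ^+ 2.
Proof. by apply: sumr_ge0 => i _; exact: sqr_ge0. Qed.

Lemma sum_cauchy_schwarz f g a b :
  (\sum_(a <= i < b) f i * g i) ^+ 2 <=
  (\sum_(a <= i < b) f i ^+ 2) * (\sum_(a <= i < b) g i ^+ 2).
Proof.
set X := \sum_(a <= i < b) _; set F := \sum_(a <= i < b) _; set G := \sum_(a <= i < b) _.
have G0 : 0 <= G by exact: sum_sqr_ge0.
have F0 : 0 <= F by exact: sum_sqr_ge0.
have key : 0 <= G * (G * F - X ^+ 2).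
  have : 0 <= \sum_(a <= i < b) (G * f i - X * g i) ^+ 2 by exact: sum_sqr_ge0.
  suff -> : \sum_(a <= i < b) (G * f i - X * g i) ^+ 2 = G * (G * F - X ^+ 2) by [].
  have E i : (G * f i - X * g i) ^+ 2 =
     G ^+ 2 * f i ^+ 2 - 2 * G * X * (f i * g i) + X ^+ 2 * g i ^+ 2 by ring.
  under eq_bigr do rewrite E.
  by rewrite big_split sumrB -!mulr_sumr -/F -/G -/X /=; ring.
have [G00|Gn0] := eqVneq G 0; last first.
  have Gp : 0 < G by rewrite lt_def Gn0.
  by move: key; rewrite pmulr_rge0// subr_ge0 mulrC.
suff -> : X = 0 by rewrite expr0n mulr_ge0.
rewrite /X big_nat big1// => i iab.
have := @psumr_eq0 _ _ (index_iota a b) xpredT (fun i => g i ^+ 2).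
rewrite -/G G00 eqxx => /(_ (fun _ _ => sqr_ge0 _))/esym/allP/(_ i).
by rewrite mem_index_iota iab sqrf_eq0 => /(_ isT)/eqP->; rewrite mulr0.
Qed.

Lemma sqr_sum_le f a b :
  (\sum_(a <= i < b) f i) ^+ 2 <= (b - a)%:R * \sum_(a <= i < b) f i ^+ 2.
Proof.
have := sum_cauchy_schwarz (fun=> 1) f a b.
under eq_bigr do rewrite mul1r.
by rewrite expr1n big_const_nat iter_addr_0.
Qed.

Lemma sum_abel f g a b : (a < b)%N ->
  \sum_(a <= i < b) f i * g i = (\sum_(a <= i < b) f i) * g b.-1 -
    \sum_(a <= i < b.-1) (\sum_(a <= k < i.+1) f k) * (g i.+1 - g i).
Proof.
elim: b => [//|b IH]; rewrite ltnS leq_eqVlt => /predU1P[<-|ab] /=.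
  by rewrite !big_nat1 big_geq// subr0.
rewrite big_nat_recr 1?ltnW//= IH//.
have -> : \sum_(a <= i < b) (\sum_(a <= k < i.+1) f k) * (g i.+1 - g i) =
   \sum_(a <= i < b.-1) (\sum_(a <= k < i.+1) f k) * (g i.+1 - g i) +
    (\sum_(a <= k < b) f k) * (g b - g b.-1).
  by case: b ab {IH} => [//|b] ab; rewrite big_nat_recr.
by rewrite [in RHS]big_nat_recr 1?ltnW//=; ring.
Qed.

Lemma sqrt_comb (x1 x2 h1 h2 : R) : 0 <= x1 -> 0 <= x2 -> 0 <= h1 -> 0 <= h2 ->
  Num.sqrt x1 * Num.sqrt h1 + Num.sqrt x2 * Num.sqrt h2 <=
  Num.sqrt (x1 + x2) * Num.sqrt (h1 + h2).
Proof.
move=> x10 x20 h10 h20.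
rewrite -[in leRHS]sqrtrM ?addr_ge0//.
set p := Num.sqrt x1; set q := Num.sqrt x2; set r := Num.sqrt h1; set s := Num.sqrt h2.
apply: (le_trans (ler_norm _)); rewrite -sqrtr_sqr ler_sqrt ?mulr_ge0 ?addr_ge0//.
have -> : x1 = p ^+ 2 by rewrite sqr_sqrtr.
have -> : x2 = q ^+ 2 by rewrite sqr_sqrtr.
have -> : h1 = r ^+ 2 by rewrite sqr_sqrtr.
have -> : h2 = s ^+ 2 by rewrite sqr_sqrtr.
by have := sqr_ge0 (p * s - q * r); nra.
Qed.

(** By the Cauchy-Schwarz inequality in the plane, a bound of the form norm
    times square root of an energy, plus a price, is inherited by the union of
    two adjacent blocks, energies and prices being added. *)
Lemma split_bound (z v : nat -> R) a c b (H1 H2 H V1 V2 V L : R) :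
    (a <= c)%N -> (c <= b)%N -> 0 <= H1 -> 0 <= H2 -> H1 + H2 <= H ->
    0 <= L -> V1 + V2 <= V ->
    \sum_(a <= i < c) z i * v i <=
      Num.sqrt (\sum_(a <= i < c) v i ^+ 2) * Num.sqrt H1 + L * V1 ->
    \sum_(c <= i < b) z i * v i <=
      Num.sqrt (\sum_(c <= i < b) v i ^+ 2) * Num.sqrt H2 + L * V2 ->
  \sum_(a <= i < b) z i * v i <=
      Num.sqrt (\sum_(a <= i < b) v i ^+ 2) * Num.sqrt H + L * V.
Proof.
move=> ac cb H10 H20 HH L0 VV h1 h2.
rewrite (big_cat_nat ac cb)/= [in leRHS](big_cat_nat ac cb)/=.
set x1 := \sum_(a <= i < c) v i ^+ 2; set x2 := \sum_(c <= i < b) v i ^+ 2.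
have := sqrt_comb (sum_sqr_ge0 v a c) (sum_sqr_ge0 v c b) H10 H20.
rewrite -/x1 -/x2 => h3.
have h4 : Num.sqrt (x1 + x2) * Num.sqrt (H1 + H2) <=
    Num.sqrt (x1 + x2) * Num.sqrt H.
  by rewrite ler_wpM2l ?sqrtr_ge0// ler_wsqrtr.
have h5 : L * (V1 + V2) <= L * V by rewrite ler_wpM2l.
rewrite mulrDr in h5; move: h1 h2; rewrite -/x1 -/x2 => h1 h2; lra.
Qed.

End sums.

(** * Affine part and residual of the noise on a block *)

Section affine_block.
Context (R : realType) (t : nat -> R).
Implicit Types (z v : nat -> R) (a b : nat).

(** [uconst] and [ulin] form an orthonormal basis of the affine sequences on the
    block; on a single point [ulin] vanishes, as division by zero gives zero. *)
Definition tmean a b : R := (\sum_(a <= i < b) t i) / (b - a)%:R.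
Definition tdev a b : R := \sum_(a <= i < b) (t i - tmean a b) ^+ 2.
Definition uconst a b (i : nat) : R := (Num.sqrt (b - a)%:R)^-1.
Definition ulin a b (i : nat) : R := (t i - tmean a b) / Num.sqrt (tdev a b).

Definition coef_const z a b := \sum_(a <= i < b) uconst a b i * z i.
Definition coef_lin z a b := \sum_(a <= i < b) ulin a b i * z i.

Definition affine_energy z a b :=
  2 * (coef_const z a b ^+ 2 + coef_lin z a b ^+ 2).

(** An upper bound for the square of the sum of the partial sums of the
    residual, in absolute value ([resid_partial_sums]).  Unlike that quantity it
    is a combination of squares of linear forms in [z], and its products with
    other such squares have computable means. *)
Definition resid_energy z a b :=
  3 * (b - a)%:R * \sum_(a <= i < b)
    ((\sum_(a <= k < i.+1) z k) ^+ 2 + (b - a)%:R * coef_const z a b ^+ 2 +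
     (b - a)%:R * coef_lin z a b ^+ 2).

Lemma affine_energy_ge0 z a b : 0 <= affine_energy z a b.
Proof. by rewrite mulr_ge0// addr_ge0 ?sqr_ge0. Qed.

Lemma resid_energy_ge0 z a b : 0 <= resid_energy z a b.
Proof.
rewrite /resid_energy; apply: mulr_ge0; first exact: mulr_ge0.
apply: sumr_ge0 => i _; have m0 : 0 <= (b - a)%:R :> R by [].
apply: addr_ge0; [apply: addr_ge0|]; rewrite ?sqr_ge0//.
all: by apply: mulr_ge0 => //; exact: sqr_ge0.
Qed.

Lemma sum_uconst_sqr a b : (a < b)%N -> \sum_(a <= i < b) uconst a b i ^+ 2 = 1.
Proof.
move=> ab; rewrite /uconst big_const_nat iter_addr_0 exprVn sqr_sqrtr//.
by rewrite -[LHS]mulr_natr mulVf// pnatr_eq0 subn_eq0 -ltnNge.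
Qed.

Lemma sum_uconst_sqr_le a b : (a < b)%N -> \sum_(a <= i < b) uconst a b i ^+ 2 <= 1.
Proof. by move=> ab; rewrite sum_uconst_sqr. Qed.

Lemma sum_ulin_sqr a b : \sum_(a <= i < b) ulin a b i ^+ 2 <= 1.
Proof.
rewrite /ulin; under eq_bigr do rewrite exprMn exprVn.
rewrite -mulr_suml sqr_sqrtr ?sum_sqr_ge0// -/(tdev a b).
by have [->|d0] := eqVneq (tdev a b) 0; rewrite ?mul0r// divff.
Qed.

Lemma sum_tmean a b : (a < b)%N -> \sum_(a <= i < b) (t i - tmean a b) = 0.
Proof.
move=> ab; rewrite sumrB big_const_nat iter_addr_0 /tmean -[X in _ - X]mulr_natr.
by rewrite divfK ?subrr// pnatr_eq0 subn_eq0 -ltnNge.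
Qed.

Lemma sum_ulin a b : (a < b)%N -> \sum_(a <= i < b) ulin a b i = 0.
Proof. by move=> ab; rewrite -mulr_suml sum_tmean// mul0r. Qed.

Definition resid z a b i :=
  z i - coef_const z a b * uconst a b i - coef_lin z a b * ulin a b i.

Lemma sum_resid z a b : (a < b)%N -> \sum_(a <= i < b) resid z a b i = 0.
Proof.
move=> ab; rewrite /resid !sumrB -!mulr_sumr sum_ulin// mulr0 subr0.
rewrite /coef_const /uconst -mulr_sumr big_const_nat iter_addr_0 -(mulr_natr _^-1).
have m0 : 0 < (b - a)%:R :> R by rewrite ltr0n subn_gt0.
rewrite -[X in _ * (_ * X)]sqr_sqrtr; last exact: ltW.
by field; rewrite gt_eqF ?sqrtr_gt0.
Qed.

Lemma sum_resid_t z a b : (a < b)%N -> \sum_(a <= i < b) resid z a b i * t i = 0.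
Proof.
move=> ab.
have -> : \sum_(a <= i < b) resid z a b i * t i =
   \sum_(a <= i < b) resid z a b i * (t i - tmean a b) +
   (\sum_(a <= i < b) resid z a b i) * tmean a b.
  by rewrite mulr_suml -big_split/=; apply: eq_bigr => i _; ring.
rewrite sum_resid// mul0r addr0.
have [d0|d0] := eqVneq (tdev a b) 0.
  rewrite big_nat big1// => i iab.
  have := @psumr_eq0 _ _ (index_iota a b) xpredT (fun i => (t i - tmean a b) ^+ 2).
  rewrite -/(tdev a b) d0 eqxx => /(_ (fun _ _ => sqr_ge0 _))/esym/allP/(_ i).
  by rewrite mem_index_iota iab sqrf_eq0 => /(_ isT)/eqP->; rewrite mulr0.
have s0 : 0 < Num.sqrt (tdev a b).
  by rewrite sqrtr_gt0 lt_def d0 sum_sqr_ge0.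
have -> : \sum_(a <= i < b) resid z a b i * (t i - tmean a b) =
   \sum_(a <= i < b) z i * (t i - tmean a b) -
   coef_const z a b * (Num.sqrt (b - a)%:R)^-1 * \sum_(a <= i < b) (t i - tmean a b)
   - coef_lin z a b * ((\sum_(a <= i < b) (t i - tmean a b) ^+ 2) /
       Num.sqrt (tdev a b)).
  rewrite mulr_suml !mulr_sumr -!sumrB; apply: eq_bigr => i _.
  by rewrite /resid /uconst /ulin; ring.
rewrite sum_tmean// mulr0 subr0 -/(tdev a b).
rewrite -[X in _ * (X / _)]sqr_sqrtr ?sum_sqr_ge0// expr2 mulfK ?gt_eqF//.
rewrite /coef_lin mulr_suml -sumrB big1// => i _.
by rewrite /ulin; field; rewrite gt_eqF.
Qed.

Lemma sqr_sum_unit_le (u : nat -> R) a b i : (i < b)%N ->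
    \sum_(a <= k < b) u k ^+ 2 <= 1 ->
  (\sum_(a <= k < i.+1) u k) ^+ 2 <= (b - a)%:R.
Proof.
move=> ib u1; apply: (le_trans (sqr_sum_le _ _ _)).
rewrite -[leRHS]mulr1; apply: ler_pM => //.
- exact: sum_sqr_ge0.
- by rewrite ler_nat leq_sub2r.
have [ai|ia] := leqP a i.+1; last by rewrite big_geq// ltnW.
apply: le_trans u1; rewrite [leRHS](big_cat_nat (n := i.+1))//= lerDl.
exact: sum_sqr_ge0.
Qed.

Lemma resid_partial_sums z a b : (a < b)%N ->
  \sum_(a <= i < b) `|\sum_(a <= k < i.+1) resid z a b k| <=
  Num.sqrt (resid_energy z a b).
Proof.
move=> ab; set S := \sum_(a <= i < b) _.
have S0 : 0 <= S by exact: sumr_ge0.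
rewrite -(ger0_norm S0) -sqrtr_sqr ler_sqrt ?resid_energy_ge0//.
apply: (le_trans (sqr_sum_le _ _ _)).
rewrite /resid_energy [3 * _]mulrC -mulrA ler_pM2l ?ltr0n ?subn_gt0//.
rewrite mulr_sumr big_nat [leRHS]big_nat; apply: ler_sum => i /andP[ai ib].
rewrite real_normK ?num_real//.
have -> : \sum_(a <= k < i.+1) resid z a b k = \sum_(a <= k < i.+1) z k -
   coef_const z a b * (\sum_(a <= k < i.+1) uconst a b k) -
   coef_lin z a b * (\sum_(a <= k < i.+1) ulin a b k).
  by rewrite !mulr_sumr -!sumrB.
have := @sqr_sum_unit_le (uconst a b) a _ _ ib.
rewrite sum_uconst_sqr// lexx => /(_ isT).
have := @sqr_sum_unit_le (ulin a b) a _ _ ib (sum_ulin_sqr a b).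
set U := \sum_(a <= k < i.+1) ulin _ _ _; set V := \sum_(a <= k < i.+1) uconst _ _ _.
set x := \sum_(a <= k < i.+1) _; set c := coef_const _ _ _; set l := coef_lin _ _ _.
move=> hU hV.
have h3 (p q r : R) : (p - q - r) ^+ 2 <= 3 * (p ^+ 2 + q ^+ 2 + r ^+ 2).
  have := sqr_ge0 (p + q); have := sqr_ge0 (p + r); have := sqr_ge0 (q - r).
  by rewrite -subr_ge0; nra.
apply: (le_trans (h3 _ _ _)); rewrite ler_pM2l// -!addrA lerD2l !exprMn.
by apply: lerD; rewrite mulrC ler_wpM2r ?sqr_ge0.
Qed.

(** The residual is orthogonal to affine sequences, so [v] may be replaced by
    [v - dl * t] against it.  As its total sum vanishes, summation by parts then
    leaves only the increments of [v - dl * t], which are at most [W]. *)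
Lemma affine_block z v (dl W : R) a b : (a < b)%N -> 0 <= W ->
    (forall i, (a <= i)%N -> (i.+1 < b)%N ->
       `|(v i.+1 - v i) - dl * (t i.+1 - t i)| <= W) ->
  \sum_(a <= i < b) z i * v i <=
    Num.sqrt (\sum_(a <= i < b) v i ^+ 2) * Num.sqrt (affine_energy z a b) +
    W * Num.sqrt (resid_energy z a b).
Proof.
move=> ab W0 hW.
have -> : \sum_(a <= i < b) z i * v i =
    (coef_const z a b * (\sum_(a <= i < b) uconst a b i * v i) +
     coef_lin z a b * (\sum_(a <= i < b) ulin a b i * v i)) +
    \sum_(a <= i < b) resid z a b i * v i.
  by rewrite !mulr_sumr -!big_split/=; apply: eq_bigr => i _; rewrite /resid; ring.
apply: lerD.
  have unit u : \sum_(a <= i < b) u i ^+ 2 <= 1 ->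
      `|\sum_(a <= i < b) u i * v i| <= Num.sqrt (\sum_(a <= i < b) v i ^+ 2).
    move=> u1; rewrite -sqrtr_sqr ler_sqrt ?sum_sqr_ge0//.
    apply: (le_trans (sum_cauchy_schwarz _ _ _ _)).
    by rewrite ler_piMl ?sum_sqr_ge0.
  have h1 := unit (uconst a b); rewrite sum_uconst_sqr// lexx in h1.
  have {}h1 := h1 isT; have h2 := unit _ (sum_ulin_sqr a b).
  set N := Num.sqrt (\sum_(a <= i < b) _) in h1 h2 *.
  have N0 : 0 <= N by exact: sqrtr_ge0.
  apply: (@le_trans _ _ (N * (`|coef_const z a b| + `|coef_lin z a b|))).
    rewrite mulrDr; apply: lerD; rewrite (le_trans (ler_norm _))// normrM mulrC;
      by rewrite ler_wpM2r.
  rewrite ler_wpM2l//.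
  set c := `|coef_const _ _ _|; set l := `|coef_lin _ _ _|.
  have c0 : 0 <= c + l by apply: addr_ge0; exact: normr_ge0.
  rewrite -(ger0_norm c0) -sqrtr_sqr ler_sqrt ?affine_energy_ge0//.
  rewrite /affine_energy -(real_normK (num_real (coef_const z a b))).
  rewrite -(real_normK (num_real (coef_lin z a b))) -/c -/l.
  by have := sqr_ge0 (c - l); nra.
have -> : \sum_(a <= i < b) resid z a b i * v i =
    \sum_(a <= i < b) resid z a b i * (v i - dl * t i).
  have dt : \sum_(a <= i < b) dl * (resid z a b i * t i) = 0.
    by rewrite -mulr_sumr sum_resid_t// mulr0.
  apply/eqP; rewrite -subr_eq0 -sumrB -[X in _ == X]dt; apply/eqP.
  by apply: eq_bigr => i _; ring.
rewrite sum_abel// sum_resid// mul0r sub0r (le_trans (ler_norm _))// normrN.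
apply: (@le_trans _ _ (W * \sum_(a <= i < b) `|\sum_(a <= k < i.+1) resid z a b k|)).
  rewrite (le_trans (ler_norm_sum _ _ _))// mulr_sumr.
  apply: (@le_trans _ _ (\sum_(a <= i < b.-1)
      W * `|\sum_(a <= k < i.+1) resid z a b k|)).
    rewrite big_nat [leRHS]big_nat; apply: ler_sum => i /andP[ai ib].
    rewrite normrM mulrC ler_wpM2r//.
    have -> : v i.+1 - dl * t i.+1 - (v i - dl * t i) =
      (v i.+1 - v i) - dl * (t i.+1 - t i) by ring.
    by apply: hW => //; case: (b) ib.
  case: (b) ab => // b' ab; rewrite [leRHS]big_nat_recr//= lerDl.
  by rewrite mulr_ge0.
by rewrite ler_wpM2l// resid_partial_sums.
Qed.

End affine_block.

(** * Slopes and their oscillation *)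

Section slopes.
Context (R : realType) (n : nat) (t : nat -> R).
Implicit Types (a b : nat).

Definition slope (v : nat -> R) i := (v i.+1 - v i) / (t i.+1 - t i).

(** [S] controls the variation of the slopes of [v]; for a difference of two
    convex sequences it is the sum of their slopes. *)
Definition slope_dominated (v S : nat -> R) :=
  forall i j, (i <= j)%N -> (j.+1 < n)%N ->
    `|slope v j - slope v i| <= S j - S i.

(** The last slope between two points of the block has index [b - 2]; the
    maximum makes the oscillation vanish on a single point. *)
Definition oscil (S : nat -> R) a b := S (maxn a (b - 2)) - S a.

Lemma oscil_ge0 v S a b : slope_dominated v S -> (a < b)%N -> (b <= n)%N ->
  0 <= oscil S a b.
Proof.
move=> vS ab bn; rewrite /oscil; have [h|h] := leqP b a.+1.
  by rewrite (_ : maxn _ _ = a) ?subrr//; lia.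
have ab2 : (a <= maxn a (b - 2))%N by lia.
by apply: le_trans (vS _ _ ab2 _); [exact: normr_ge0|lia].
Qed.

(** Superadditivity is what makes bisection free as far as the price of the
    residuals is concerned. *)
Lemma oscil_split v S a c b : slope_dominated v S ->
    (a < c)%N -> (c < b)%N -> (b <= n)%N ->
  oscil S a c + oscil S c b <= oscil S a b.
Proof.
move=> vS ac cb bn; rewrite /oscil.
have mono i j : (i <= j)%N -> (j.+1 < n)%N -> S i <= S j.
  move=> ij jn; rewrite -subr_ge0; apply: le_trans (vS _ _ ij jn).
  exact: normr_ge0.
have -> : maxn a (b - 2) = (b - 2)%N by lia.
have h1 : S (maxn a (c - 2)) <= S (b - 2)%N by apply: mono; lia.
have [h|h] := leqP c.+2 b; last by rewrite (_ : maxn c _ = c); [lra|lia].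
have -> : maxn c (b - 2) = (b - 2)%N by lia.
have h2 : S (maxn a (c - 2)) <= S c by apply: mono; lia.
by lra.
Qed.

Lemma midpoint_split N a b : (1 < b - a)%N -> (b - a <= N.+1)%N ->
  exists c, [/\ (a < c)%N, (c < b)%N, (c - a <= N)%N /\ (b - c <= N)%N,
    ((c - a) + (b - c) = b - a)%N &
    (b - a <= 3 * (c - a))%N /\ (b - a <= 3 * (b - c))%N].
Proof. by move=> h1 h2; exists (a + (b - a)./2)%N; split; lia. Qed.

Lemma oscil_single S a b : (b - a <= 1)%N -> oscil S a b = 0.
Proof. by move=> h; rewrite /oscil (_ : maxn _ _ = a) ?subrr//; lia. Qed.

End slopes.

(** * Adaptive bisection of a block *)

Section superadditive.
Context (R : realType).

(** A function of order [min x (x ^+ 2)].  It grows linearly, and it is strictly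
    superadditive at every scale: in [recursion_block] the gap between a block
    and its two halves pays for the bisection. *)
Definition budget (x : R) := x ^+ 2 / (1 + x).

Lemma budget_ge0 x : 0 <= x -> 0 <= budget x.
Proof. by move=> x0; rewrite divr_ge0 ?sqr_ge0// addr_ge0. Qed.

Lemma budget_le x : 0 <= x -> budget x <= x.
Proof. by move=> x0; rewrite ler_pdivrMr; [nra|lra]. Qed.

Lemma budget_gap p q : 0 <= p -> 0 <= q ->
  p / (1 + p) * (q / (1 + q)) + budget p + budget q <= budget (p + q).
Proof.
move=> p0 q0; rewrite -subr_ge0 /budget.
have -> : (p + q) ^+ 2 / (1 + (p + q)) -
    (p / (1 + p) * (q / (1 + q)) + p ^+ 2 / (1 + p) + q ^+ 2 / (1 + q)) =
    p * q / ((1 + (p + q)) * ((1 + p) * (1 + q))).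
  by field; rewrite !gt_eqF//; lra.
by rewrite divr_ge0 ?mulr_ge0//; lra.
Qed.

Lemma budget_gap_large p q : 1 <= p + q -> p + q <= 3 * p -> p + q <= 3 * q ->
  1 / 16 + budget p + budget q <= budget (p + q).
Proof.
move=> pq1 hp hq; apply: le_trans (budget_gap _ _); [|lra|lra].
have h (y : R) : 1 / 3 <= y -> 1 / 4 <= y / (1 + y) by move=> ?; rewrite ler_pdivlMr; lra.
have := h p; have := h q.
set P := p / _; set Q := q / _.
move=> /(_ ltac:(lra)) hQ /(_ ltac:(lra)) hP.
by rewrite -!addrA lerD2r; nra.
Qed.

Lemma budget_gap_small p q : 0 <= p -> 0 <= q -> p + q <= 1 ->
  p + q <= 3 * p -> p + q <= 3 * q ->
  (p + q) ^+ 3 / 36 + budget p + budget q <= budget (p + q).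
Proof.
move=> p0 q0 pq1 hp hq; apply: le_trans (budget_gap _ _) => //.
have h (y : R) : 0 <= y -> y <= 1 -> y / 2 <= y / (1 + y).
  by move=> ? ?; rewrite ler_wpM2l// lef_pV2 ?posrE; lra.
have := h p p0 ltac:(lra); have := h q q0 ltac:(lra).
set P := p / (1 + p); set Q := q / (1 + q) => hQ hP.
rewrite -!addrA lerD2r.
have : (p + q) / 6 <= P by lra.
have : (p + q) / 6 <= Q by lra.
set x := p + q in pq1 hp hq * => xQ xP.
have x0 : 0 <= x by rewrite addr_ge0.
have : x ^+ 3 <= x ^+ 2 by rewrite exprS ler_piMl ?sqr_ge0.
have : (x / 6) * (x / 6) <= P * Q by apply: ler_pM => //; lra.
by rewrite expr2; lra.
Qed.

End superadditive.

Section recursion.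
Context d (T : measurableType d) (R : realType) (P : probability T R).
Variables (n : nat) (s M : R) (Z : nat -> T -> R) (t : nat -> R).
Hypotheses (s0 : 0 < s) (M1 : 1 <= M) (hZ : lform_moment4 P n s M Z).
Implicit Types (a b : nat).

Lemma mean_affine_energy a b : (a < b)%N -> (b <= n)%N ->
  mean_le P (fun w => affine_energy t (Z^~ w) a b) (4 * M * s ^+ 2).
Proof.
move=> ab bn.
have h1 := lform_moment2 s0 M1 hZ bn ltr01 (sum_uconst_sqr_le R ab).
have h2 := lform_moment2 s0 M1 hZ bn ltr01 (sum_ulin_sqr t a b).
apply: mean_leW (mean_leZ (ler0n R 2) (mean_leD h1 h2)).
by rewrite !mulr1; lra.
Qed.

(** Partial sums over a block of [m] points have variance of order [m * s ^+ 2];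
    [m] of them are added, and the prefactor contributes another [m].  Hence the
    cube, that is, residuals of order [s * m ^ (3/2)]. *)
Lemma mean_energy_prod a b a' b' : (a < b)%N -> (b <= n)%N ->
    (a' < b')%N -> (b' <= n)%N ->
  mean_le P (fun w => resid_energy t (Z^~ w) a b * affine_energy t (Z^~ w) a' b')
    (36 * M * s ^+ 4 * (b - a)%:R ^+ 3).
Proof.
move=> ab bn ab' bn'.
set m : R := (b - a)%:R.
have m0 : 0 < m by rewrite ltr0n subn_gt0.
have hu := (sum_uconst_sqr_le R ab); have hl := sum_ulin_sqr t a b.
have hu' := (sum_uconst_sqr_le R ab'); have hl' := sum_ulin_sqr t a' b'.
have piece (c : nat -> R) x y q : (y <= n)%N -> 0 < q ->
    \sum_(x <= k < y) c k ^+ 2 <= q ->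
    mean_le P (fun w => (\sum_(x <= k < y) c k * Z k w) ^+ 2 *
      (coef_const (Z^~ w) a' b' ^+ 2 + coef_lin t (Z^~ w) a' b' ^+ 2))
     (2 * M * s ^+ 4 * q).
  move=> yn q0 cq.
  have h1 := lform_moment22 hZ yn bn' q0 ltr01 cq hu'.
  have h2 := lform_moment22 hZ yn bn' q0 ltr01 cq hl'.
  apply: mean_leW (mean_le_ext _ (mean_leD h1 h2)); first by rewrite mulr1; lra.
  by move=> w; rewrite mulrDr.
have term i : (a <= i < b)%N -> mean_le P (fun w =>
    ((\sum_(a <= k < i.+1) Z k w) ^+ 2 + m * coef_const (Z^~ w) a b ^+ 2 +
      m * coef_lin t (Z^~ w) a b ^+ 2) *
      (coef_const (Z^~ w) a' b' ^+ 2 + coef_lin t (Z^~ w) a' b' ^+ 2))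
    (6 * M * s ^+ 4 * m).
  move=> /andP[ai ib].
  have hS : \sum_(a <= k < i.+1) (fun=> 1 : R) k ^+ 2 <= m.
    by rewrite expr1n big_const_nat iter_addr_0 ler_nat leq_sub2r.
  have h1 := piece _ _ _ _ (leq_trans ib bn) m0 hS.
  have h2 := mean_leZ (ltW m0) (piece _ _ _ _ bn ltr01 hu).
  have h3 := mean_leZ (ltW m0) (piece _ _ _ _ bn ltr01 hl).
  apply: mean_leW (mean_le_ext _ (mean_leD (mean_leD h1 h2) h3)); first lra.
  move=> w.
  have -> : \sum_(a <= k < i.+1) 1 * Z k w = \sum_(a <= k < i.+1) Z k w.
    by apply: eq_bigr => k _; rewrite mul1r.
  by rewrite /coef_const /coef_lin; ring.
have k0 : 0 <= 6 * m by rewrite mulr_ge0// ltW.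
apply: mean_leW (mean_le_ext _ (mean_leZ k0 (mean_le_sum term))).
  by rewrite -/m; lra.
by move=> w; rewrite /resid_energy /affine_energy -/m -mulr_suml; ring.
Qed.

Variables (kappa nu : R).
Hypotheses (kappa0 : 0 < kappa) (nu0 : 0 < nu).
Hypothesis t_gap : forall i, (i.+1 < n)%N -> 0 < t i.+1 - t i <= kappa.

Lemma affine_block_slope (z v S : nat -> R) a b : slope_dominated n t v S ->
    (a < b)%N -> (b <= n)%N ->
  \sum_(a <= i < b) z i * v i <=
    Num.sqrt (\sum_(a <= i < b) v i ^+ 2) * Num.sqrt (affine_energy t z a b) +
    kappa * oscil S a b * Num.sqrt (resid_energy t z a b).
Proof.
move=> vS ab bn; apply: (@affine_block _ t z v (slope t v a)) => //.
  by rewrite mulr_ge0 ?(ltW kappa0)// (oscil_ge0 vS).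
move=> i ai ib.
have /andP[g0 gk] := t_gap (leq_trans ib bn).
have -> : v i.+1 - v i - slope t v a * (t i.+1 - t i) =
    (slope t v i - slope t v a) * (t i.+1 - t i).
  by rewrite mulrBl [X in X * _ - _]/slope divfK ?gt_eqF.
rewrite normrM (ger0_norm (ltW g0)) mulrC; apply: ler_pM => //; first exact: ltW.
have ib2 : (i <= b - 2)%N by lia.
apply: (le_trans (vS _ _ ai _)); first exact: leq_trans ib bn.
rewrite /oscil lerD2r (maxn_idPr (leq_trans ai ib2)) -subr_ge0.
apply: le_trans (vS _ _ ib2 _); first exact: normr_ge0.
by apply: leq_trans bn; lia.
Qed.

Definition block_bound a b (D : T -> R) :=
  forall w v S, slope_dominated n t v S ->
  \sum_(a <= i < b) Z i w * v i <=
    Num.sqrt (\sum_(a <= i < b) v i ^+ 2) *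
      Num.sqrt (affine_energy t (Z^~ w) a b + D w) +
    kappa * s * nu ^+ 3 * oscil S a b.

(* Bisecting a small block of relative size [x] costs [72 * M * s ^+ 2 * x ^+ 3]
   in the mean, and the gap of [budget] is [x ^+ 3 / 36]. *)
Variable alpha : R.
Hypothesis alpha_ge : 36 * (72 * M) <= alpha.

(** Bisection with threshold [s * nu ^+ 3] on the residual.  Blocks of at least
    [nu ^+ 2] points are always cut, and the two new affine energies have mean
    of order [s ^+ 2].  For smaller blocks the new energies are multiplied by the
    ratio of [resid_energy] to the square of the threshold.  This ratio is at
    least [1] whenever a cut is necessary, and for a block of relative size
    [x = (b - a) / nu ^+ 2] it makes the mean cost of order
    [s ^+ 2 * x ^+ 3].  Either cost fits in the gap of [budget], so the costs of
    the whole tree of bisections sum to [budget]. *)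
Lemma recursion_block N a b : (b - a <= N)%N -> (a < b)%N -> (b <= n)%N ->
  exists2 D : T -> R,
    mean_le P D (alpha * s ^+ 2 * budget ((b - a)%:R / nu ^+ 2)) &
    block_bound a b D.
Proof.
have M0 : 0 < M by apply: lt_le_trans M1.
have al0 : 0 <= alpha by apply: le_trans alpha_ge; do 2 apply: mulr_ge0 => //; exact: ltW.
have as0 : 0 <= alpha * s ^+ 2 by apply: mulr_ge0 => //; exact: sqr_ge0.
have L0 : 0 <= kappa * s * nu ^+ 3.
  by apply: mulr_ge0; [apply: mulr_ge0; exact: ltW|rewrite exprn_ge0// ltW].
have nu2 : 0 < nu ^+ 2 by rewrite exprn_gt0.
elim: N a b => [|N IH] a b baN ab bn.
  by move: baN; rewrite leqn0 subn_eq0 leqNgt ab.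
have [b1|b1] := leqP (b - a) 1.
  exists (fun=> 0).
    apply: mean_leW (mean_le_cst P (lexx 0)).
    by apply: mulr_ge0 => //; apply: budget_ge0; apply: divr_ge0 => //; exact: ltW.
  move=> w v S vS; rewrite addr0.
  have := affine_block_slope (Z^~ w) vS ab bn.
  by rewrite oscil_single// !mulr0 !mul0r.
have [c [ac cb [caN bcN] cab [c3 c3']]] := midpoint_split b1 baN.
have cn := leq_trans (ltnW cb) bn.
have [D1 mD1 bD1] := IH a c caN ac cn.
have [D2 mD2 bD2] := IH c b bcN cb bn.
have D10 w : 0 <= D1 w by case: mD1.
have D20 w : 0 <= D2 w by case: mD2.
pose A1 w := affine_energy t (Z^~ w) a c; pose A2 w := affine_energy t (Z^~ w) c b.
have A10 w : 0 <= A1 w by exact: affine_energy_ge0.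
have A20 w : 0 <= A2 w by exact: affine_energy_ge0.
pose p : R := (c - a)%:R / nu ^+ 2; pose q : R := (b - c)%:R / nu ^+ 2.
have p0 : 0 <= p by apply: divr_ge0 => //; exact: ltW.
have q0 : 0 <= q by apply: divr_ge0 => //; exact: ltW.
have pq : (b - a)%:R / nu ^+ 2 = p + q.
  by rewrite /p /q -mulrDl -natrD cab.
have hp : p + q <= 3 * p.
  by rewrite -pq /p mulrA ler_pM2r ?invr_gt0// -natrM ler_nat.
have hq : p + q <= 3 * q.
  by rewrite -pq /q mulrA ler_pM2r ?invr_gt0// -natrM ler_nat.
have split w v S (H : R) : slope_dominated n t v S -> (A1 w + D1 w) + (A2 w + D2 w) <= H ->
    \sum_(a <= i < b) Z i w * v i <=
    Num.sqrt (\sum_(a <= i < b) v i ^+ 2) * Num.sqrt H +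
    kappa * s * nu ^+ 3 * oscil S a b.
  move=> vS hH.
  apply: (split_bound (ltnW ac) (ltnW cb) _ _ hH L0 (oscil_split vS ac cb bn)
    (bD1 w v S vS) (bD2 w v S vS)); by rewrite addr_ge0.
rewrite pq.
have [big|small] := leP 1 (p + q).
  exists (fun w => A1 w + A2 w + (D1 w + D2 w)).
    have h := mean_leD (mean_leD (mean_affine_energy ac cn) (mean_affine_energy cb bn))
      (mean_leD mD1 mD2).
    apply: mean_leW h; rewrite -/p -/q.
    have := ler_wpM2l as0 (budget_gap_large big hp hq).
    have := ler_wpM2r (sqr_ge0 s) alpha_ge.
    rewrite !mulrDr; move: (alpha * s ^+ 2 * budget p) (alpha * s ^+ 2 * budget q).
    move: (alpha * s ^+ 2 * budget _) => A B C.
    have : 0 <= M * s ^+ 2 by apply: mulr_ge0; [exact: ltW|exact: sqr_ge0].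
    move: (alpha * s ^+ 2) => V; lra.
  move=> w v S vS; apply: split => //.
  by apply: (le_trans _ (_ : A1 w + A2 w + (D1 w + D2 w) <= _)); [
     rewrite addrACA|rewrite lerDr affine_energy_ge0].
pose r := (s ^+ 2 * nu ^+ 6)^-1.
have r0 : 0 < r by rewrite invr_gt0 mulr_gt0 ?exprn_gt0.
pose E w := resid_energy t (Z^~ w) a b.
exists (fun w => r * (E w * A1 w + E w * A2 w) + (D1 w + D2 w)).
  have h := mean_leD (mean_leZ (ltW r0) (mean_leD
    (mean_energy_prod ab bn ac cn) (mean_energy_prod ab bn cb bn)))
      (mean_leD mD1 mD2).
  apply: mean_leW h; rewrite -/p -/q.
  have pq0 : 0 <= (p + q) ^+ 3 / 36 by apply: divr_ge0 => //; rewrite exprn_ge0// addr_ge0.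
  have := ler_wpM2l as0 (budget_gap_small p0 q0 (ltW small) hp hq).
  have := ler_wpM2r pq0 (ler_wpM2r (sqr_ge0 s) alpha_ge); rewrite !mulrDr.
  have -> : 36 * (72 * M) * s ^+ 2 * ((p + q) ^+ 3 / 36) =
    r * (36 * M * s ^+ 4 * (b - a)%:R ^+ 3) + r * (36 * M * s ^+ 4 * (b - a)%:R ^+ 3).
    by rewrite -pq /r; field; rewrite !gt_eqF.
  move: (alpha * s ^+ 2 * budget p) (alpha * s ^+ 2 * budget q) (alpha * s ^+ 2 * budget _).
  move: (r * _) (alpha * _ * _) => U V A B C; lra.
move=> w v S vS.
have E0 : 0 <= E w by exact: resid_energy_ge0.
(* Either the residual is below the threshold and the block is kept whole, or
   the factor [r * E w] is at least 1. *)
have [stop|go] := leP (E w) (s ^+ 2 * nu ^+ 6).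
  apply: (le_trans (affine_block_slope _ vS ab bn)); apply: lerD.
    have EA0 : 0 <= r * (E w * A1 w + E w * A2 w).
      apply: mulr_ge0; [exact: ltW|apply: addr_ge0; exact: mulr_ge0].
    rewrite ler_wpM2l ?sqrtr_ge0// ler_wsqrtr// lerDl.
    by apply: addr_ge0 => //; exact: addr_ge0.
  have -> : kappa * s * nu ^+ 3 * oscil S a b =
    kappa * oscil S a b * (s * nu ^+ 3) by ring.
  rewrite ler_wpM2l//; first by rewrite mulr_ge0 ?(ltW kappa0)// (oscil_ge0 vS).
  have sn : 0 <= s * nu ^+ 3 by rewrite mulr_ge0 ?exprn_ge0// ltW.
  rewrite -(ger0_norm sn) -sqrtr_sqr ler_sqrt ?sqr_ge0// exprMn -exprM//.
apply: split => //.
have rE : 1 <= r * E w by rewrite /r mulrC ler_pdivlMr ?mul1r ?(ltW go)// mulr_gt0 ?exprn_gt0.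
have : A1 w + A2 w <= r * (E w * A1 w + E w * A2 w).
  have -> : r * (E w * A1 w + E w * A2 w) = (r * E w) * (A1 w + A2 w) by ring.
  by apply: ler_peMl => //; exact: addr_ge0.
have := affine_energy_ge0 t (Z^~ w) a b.
move: (affine_energy _ _ _ _) (A1 w) (A2 w) (D1 w) (D2 w) (r * _) => *; lra.
Qed.

End recursion.

(** * Slopes of convex sequences away from the ends *)

Section convex_sequences.
Context (R : realType) (n : nat) (t : nat -> R).
Hypothesis t_gap1 : forall i, (i.+1 < n)%N -> 1 <= t i.+1 - t i.
Implicit Types g : nat -> R.

Definition convex_seq g :=
  forall i j, (i <= j)%N -> (j.+1 < n)%N -> slope t g i <= slope t g j.

(** If [g] changes by at least [dl * h] between [i] and [i + h], one of the two
    values is at least [dl * h / 2] in absolute value; the window contains [h]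
    disjoint pairs of this kind. *)
Lemma window_bound g (dl : R) x h : (x + h + h <= n)%N ->
    (forall i, (x <= i < x + h)%N -> (dl * h%:R) ^+ 2 <= (g (i + h)%N - g i) ^+ 2) ->
  dl ^+ 2 * h%:R ^+ 3 <= 2 * \sum_(0 <= i < n) g i ^+ 2.
Proof.
move=> xn H.
have -> : dl ^+ 2 * h%:R ^+ 3 = \sum_(x <= i < x + h) (dl * h%:R) ^+ 2.
  by rewrite big_const_nat iter_addr_0 addKn -[RHS]mulr_natr; ring.
apply: (@le_trans _ _ (\sum_(x <= i < x + h) 2 * (g (i + h)%N ^+ 2 + g i ^+ 2))).
  rewrite big_nat [leRHS]big_nat; apply: ler_sum => i /H hi; apply: (le_trans hi).
  by have := sqr_ge0 (g (i + h)%N + g i); nra.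
rewrite -mulr_sumr ler_pM2l// big_split/=.
have -> : \sum_(x <= i < x + h) g (i + h)%N ^+ 2 =
    \sum_(x + h <= i < x + h + h) g i ^+ 2 by rewrite [RHS]big_addn addnK.
rewrite addrC -big_cat_nat ?leq_addr//=.
rewrite [leRHS](@big_cat_nat _ _ _ x)//=; last by lia.
rewrite [X in _ <= _ + X](@big_cat_nat _ _ _ (x + h + h))//=; last by lia.
by rewrite addrCA lerDl addr_ge0 ?sum_sqr_ge0.
Qed.

Lemma slope_steps g (dl : R) i k : (forall l, (i <= l < i + k)%N -> dl <= slope t g l) ->
  0 <= dl -> (i + k < n)%N -> dl * k%:R <= g (i + k)%N - g i.
Proof.
elim: k => [|k IH] H dl0 ikn; first by rewrite addn0 mulr0 subrr.
have g1 : 1 <= t (i + k).+1 - t (i + k)%N by apply: t_gap1; lia.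
have g0 : 0 < t (i + k).+1 - t (i + k)%N by apply: lt_le_trans g1.
have h1 : dl <= g (i + k).+1 - g (i + k)%N.
  have := H (i + k)%N ltac:(lia); rewrite /slope ler_pdivlMr//; apply: le_trans.
  by rewrite ler_peMr.
have h2 : dl * k%:R <= g (i + k)%N - g i.
  by apply: IH => // [l hl|]; [apply: H; lia|lia].
rewrite addnS -natr1 mulrDr mulr1; lra.
Qed.

Lemma slope_steps_down g (dl : R) i k :
  (forall l, (i <= l < i + k)%N -> slope t g l <= - dl) ->
  0 <= dl -> (i + k < n)%N -> dl * k%:R <= g i - g (i + k)%N.
Proof.
move=> H dl0 ikn.
have := @slope_steps (fun j => - g j) dl i k _ dl0 ikn.
rewrite opprK addrC; apply => l hl.
have -> : slope t (fun j => - g j) l = - slope t g l.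
  by rewrite /slope -mulNr; congr (_ / _); ring.
by have := H l hl; lra.
Qed.

(** To the right of [j] the slopes are at least that at [j], so a nonnegative
    slope at [j] forces a growth that the sum of squares must pay for. *)
Lemma slope_upper_bound g j h : convex_seq g -> (j + h + h <= n)%N -> (0 < h)%N ->
  0 <= slope t g j ->
  slope t g j ^+ 2 * h%:R ^+ 3 <= 2 * \sum_(0 <= i < n) g i ^+ 2.
Proof.
move=> cg jn h0 s0; apply: (window_bound jn) => i /andP[ji ih].
have st : slope t g j * h%:R <= g (i + h)%N - g i.
  by apply: slope_steps => // [l hl|]; [apply: cg; lia|lia].
have sh : 0 <= slope t g j * h%:R by exact: mulr_ge0.
by rewrite lerXn2r ?nnegrE// (le_trans sh).
Qed.

Lemma slope_lower_bound g j h : convex_seq g -> (h + h <= j.+2)%N -> (j.+1 < n)%N ->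
  (0 < h)%N -> slope t g j <= 0 ->
  slope t g j ^+ 2 * h%:R ^+ 3 <= 2 * \sum_(0 <= i < n) g i ^+ 2.
Proof.
move=> cg hj jn h0 s0.
have s0' : 0 <= - slope t g j by rewrite oppr_ge0.
rewrite -sqrrN; apply: (@window_bound _ _ 0); first lia.
move=> i /andP[_ ih]; rewrite -[leRHS]sqrrN opprB.
have st : - slope t g j * h%:R <= g i - g (i + h)%N.
  apply: slope_steps_down => //; last lia.
  by move=> l hl; rewrite opprK; apply: cg; lia.
have sh : 0 <= - slope t g j * h%:R by exact: mulr_ge0.
by rewrite lerXn2r ?nnegrE// (le_trans sh).
Qed.

(** The last slope of the block is bounded above by what lies to its right, the
    first one below by what lies to its left.  On both sides there are windows
    of [2 * h] points with [4 * h >= b - a], and [2 * 4 ^ 3 <= 12 ^ 2]. *)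
Lemma slope_range g a b : convex_seq g -> (a.+1 < b)%N -> (b <= n)%N ->
    (b - a <= 2 * a)%N -> (b - a <= 2 * (n - b))%N ->
  (slope t g (b - 2) - slope t g a) * Num.sqrt (b - a)%:R ^+ 3 <=
    24 * Num.sqrt (\sum_(0 <= i < n) g i ^+ 2).
Proof.
move=> cg ab bn h1 h2.
set G := \sum_(0 <= i < n) _; set m := Num.sqrt _.
have G0 : 0 <= G by exact: sum_sqr_ge0.
have m0 : 0 <= m by exact: sqrtr_ge0.
have m2 : m ^+ 2 = (b - a)%:R by rewrite sqr_sqrtr.
have half (x : R) h : (b - a <= 4 * h)%N -> 0 <= x -> x ^+ 2 * h%:R ^+ 3 <= 2 * G ->
    x * m ^+ 3 <= 12 * Num.sqrt G.
  move=> bah x0 hx.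
  have xm0 : 0 <= x * m ^+ 3 by rewrite mulr_ge0 ?exprn_ge0.
  have -> : 12 * Num.sqrt G = Num.sqrt (144 * G).
    rewrite sqrtrM//; congr (_ * _).
    by rewrite (_ : 144 = 12 ^+ 2) ?sqrtr_sqr ?ger0_norm//; ring.
  rewrite -(ger0_norm xm0) -sqrtr_sqr ler_sqrt ?mulr_ge0// exprMn -exprM mulnC exprM m2.
  have : (b - a)%:R ^+ 3 <= (4 * h%:R) ^+ 3 :> R.
    by rewrite lerXn2r ?nnegrE ?mulr_ge0// -natrM ler_nat.
  move=> /(ler_wpM2l (sqr_ge0 x)); rewrite exprMn; lra.
have up : slope t g (b - 2) * m ^+ 3 <= 12 * Num.sqrt G.
  have [s0|s0] := leP 0 (slope t g (b - 2)); last first.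
    apply: (@le_trans _ _ 0); last by rewrite mulr_ge0 ?sqrtr_ge0.
    by rewrite mulr_le0_ge0 ?exprn_ge0// ltW.
  apply: (half _ ((n - b).+2)./2) => //; first lia.
  by apply: slope_upper_bound => //; lia.
have lo : - slope t g a * m ^+ 3 <= 12 * Num.sqrt G.
  have [s0|s0] := leP 0 (- slope t g a); last first.
    apply: (@le_trans _ _ 0); last by rewrite mulr_ge0 ?sqrtr_ge0.
    by rewrite mulr_le0_ge0 ?exprn_ge0// ltW.
  apply: (half _ (a.+2)./2) => //; first lia.
  rewrite sqrrN; apply: slope_lower_bound => //; [lia|lia|].
  by rewrite -oppr_ge0.
rewrite mulrBl; rewrite mulNr in lo; lra.
Qed.

Lemma slope_dominated_convex g1 g2 v : convex_seq g1 -> convex_seq g2 ->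
    (forall i, v i = g1 i - g2 i) ->
  slope_dominated n t v (fun i => slope t g1 i + slope t g2 i).
Proof.
move=> c1 c2 vE i j ij jn.
have sE k : slope t v k = slope t g1 k - slope t g2 k.
  by rewrite /slope !vE -mulrBl; congr (_ / _); ring.
rewrite !sE ler_norml.
have := c1 i j ij jn; have := c2 i j ij jn.
move: (slope t g1 i) (slope t g1 j) (slope t g2 i) (slope t g2 j) => x1 y1 x2 y2 h2 h1.
by apply/andP; split; lra.
Qed.

End convex_sequences.

(** * Cutting the design into logarithmically many blocks *)

Section partition.
Context d (T : measurableType d) (R : realType) (P : probability T R).
Variables (n : nat) (s M : R) (Z : nat -> T -> R) (t : nat -> R).
Variables (kappa alpha y : R).
Hypotheses (s0 : 0 < s) (M1 : 1 <= M) (hZ : lform_moment4 P n s M Z).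
Hypotheses (kappa0 : 0 < kappa) (alpha_ge : 36 * (72 * M) <= alpha) (y1 : 1 <= y).
Hypothesis t_gap : forall i, (i.+1 < n)%N -> 1 <= t i.+1 - t i <= kappa.

Definition sumsq (g : nat -> R) := \sum_(0 <= i < n) g i ^+ 2.

(** The block is cut into [k] pieces away from the ends, or reduced to a point.
    The same [H] serves all pairs of convex sequences, in particular a pair that
    depends on the noise.  The factor [1] puts the bound in the form of
    [split_bound]. *)
Definition controlled a b k := exists2 H : T -> R,
  mean_le P H (k%:R * (4 * M * s ^+ 2 + alpha * s ^+ 2 * y ^+ 2)) &
  forall w v g1 g2, (forall i, v i = g1 i - g2 i) ->
    convex_seq n t g1 -> convex_seq n t g2 ->
    \sum_(a <= i < b) Z i w * v i <=
      Num.sqrt (\sum_(a <= i < b) v i ^+ 2) * Num.sqrt (H w) +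
      1 * (k%:R * (24 * kappa * s / y ^+ 3 *
        (Num.sqrt (sumsq g1) + Num.sqrt (sumsq g2)))).

Lemma controlled_cat a c b k l : (a <= c)%N -> (c <= b)%N ->
  controlled a c k -> controlled c b l -> controlled a b (k + l).
Proof.
move=> ac cb [H1 m1 h1] [H2 m2 h2]; exists (fun w => H1 w + H2 w).
  by rewrite natrD mulrDl; exact: mean_leD.
move=> w v g1 g2 vE c1 c2.
have H10 : 0 <= H1 w by case: m1.
have H20 : 0 <= H2 w by case: m2.
apply: (split_bound ac cb H10 H20 (lexx _) ler01 _
  (h1 w v g1 g2 vE c1 c2) (h2 w v g1 g2 vE c1 c2)).
by rewrite natrD (mulrDl k%:R l%:R).
Qed.

(** The scale [nu = sqrt (b - a) / y] makes the expected number of pieces of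
    order [y ^+ 2] and cancels the size of the block against the bound of
    [slope_range]. *)
Lemma controlled_block a b : (a < b)%N -> (b <= n)%N ->
    ((b - a <= 1) || ((b - a <= 2 * a) && (b - a <= 2 * (n - b))))%N ->
  controlled a b 1.
Proof.
move=> ab bn good.
have y0 : 0 < y by apply: lt_le_trans y1.
have N0 : 0 < (b - a)%:R :> R by rewrite ltr0n subn_gt0.
pose nu := Num.sqrt (b - a)%:R / y.
have nu0 : 0 < nu by rewrite divr_gt0// sqrtr_gt0.
have gap i : (i.+1 < n)%N -> 0 < t i.+1 - t i <= kappa.
  by move=> /t_gap /andP[h ->]; rewrite (lt_le_trans _ h).
have gap1 i : (i.+1 < n)%N -> 1 <= t i.+1 - t i by move=> /t_gap /andP[].
have [D mD bD] := recursion_block s0 M1 hZ kappa0 nu0 gap alpha_ge (leqnn _) ab bn.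
have M0 : 0 <= M by exact: le_trans ler01 M1.
have as0 : 0 <= alpha * s ^+ 2.
  apply: mulr_ge0 (sqr_ge0 _); apply: le_trans alpha_ge.
  by apply: mulr_ge0 => //; exact: mulr_ge0.
exists (fun w => affine_energy t (Z^~ w) a b + D w).
  rewrite mul1r; apply: mean_leD; first exact: (mean_affine_energy t s0 M1 hZ ab bn).
  apply: mean_leW mD; apply: ler_wpM2l => //.
  have -> : (b - a)%:R / nu ^+ 2 = y ^+ 2.
    rewrite /nu exprMn exprVn sqr_sqrtr ?(ltW N0)//.
    by field; rewrite !gt_eqF.
  by apply: budget_le; exact: sqr_ge0.
move=> w v g1 g2 vE c1 c2.
have vS := slope_dominated_convex c1 c2 vE.
apply: (le_trans (bD w v _ vS)); rewrite lerD2l !mul1r.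
have C0 : 0 <= 24 * kappa * s / y ^+ 3.
  apply: divr_ge0; last by rewrite exprn_ge0// ltW.
  by apply: mulr_ge0; [apply: mulr_ge0 => //|]; exact: ltW.
have [b1|b1] := leqP (b - a) 1.
  rewrite oscil_single// mulr0; apply: mulr_ge0 => //.
have [g1' g2'] : (b - a <= 2 * a)%N /\ (b - a <= 2 * (n - b))%N.
  by move: good; rewrite leqNgt b1 /= => /andP[].
have ab2 : (a.+1 < b)%N by clear -b1; lia.
have r1 := slope_range gap1 c1 ab2 bn g1' g2'.
have r2 := slope_range gap1 c2 ab2 bn g1' g2'.
rewrite /oscil (_ : maxn a (b - 2) = (b - 2)%N); last by clear -ab2; lia.
rewrite /nu exprMn exprVn.
move: r1 r2; rewrite -/(sumsq g1) -/(sumsq g2).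
move: (slope t g1 _) (slope t g1 _) (slope t g2 _) (slope t g2 _) => p1 q1 p2 q2.
move: (Num.sqrt (sumsq g1)) (Num.sqrt (sumsq g2)) (Num.sqrt _ ^+ 3) => G1 G2 m r1 r2.
have k0 : 0 <= kappa * s / y ^+ 3.
  apply: divr_ge0; last by rewrite exprn_ge0// ltW.
  by apply: mulr_ge0; exact: ltW.
have : (q1 - p1) * m + (q2 - p2) * m <= 24 * G1 + 24 * G2 by exact: lerD.
move=> /(ler_wpM2l k0); lra.
Qed.

(** The upper half of the first [m] points is as far from both ends as it is
    long, up to a constant. *)
Lemma controlled_left m : (0 < m)%N -> (2 * m <= n.+1)%N ->
  exists2 k, controlled 0 m k & (2 ^ k <= 2 * m)%N.
Proof.
elim/ltn_ind: m => m IH m0 mn.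
have [m1|m1] := leqP m 1.
  exists 1%N; last by lia.
  by apply: controlled_block => //; [lia|rewrite subn0 m1].
have [k ck hk] := IH m./2 ltac:(lia) ltac:(lia) ltac:(lia).
exists (k + 1)%N; last by rewrite addn1 expnS; lia.
apply: (@controlled_cat _ m./2) => //; first by lia.
by apply: controlled_block; lia.
Qed.

Lemma controlled_right m : (0 < m)%N -> (2 * m <= n.+1)%N ->
  exists2 k, controlled (n - m) n k & (2 ^ k <= 2 * m)%N.
Proof.
elim/ltn_ind: m => m IH m0 mn.
have [m1|m1] := leqP m 1.
  exists 1%N; last by lia.
  apply: controlled_block; [lia|lia|].
  by apply/orP; left; lia.
have [k ck hk] := IH m./2 ltac:(lia) ltac:(lia) ltac:(lia).
exists (1 + k)%N; last by rewrite add1n expnS; lia.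
apply: (@controlled_cat _ (n - m./2)) => //; [lia|lia|].
by apply: controlled_block; [lia|lia|apply/orP; right; lia].
Qed.

Lemma controlled_all : (2 <= n)%N ->
  exists2 k, controlled 0 n k & (2 ^ k <= n ^ 2)%N.
Proof.
move=> n2.
have [k ck hk] := @controlled_left n./2 ltac:(lia) ltac:(lia).
have [l cl hl] := @controlled_right (n - n./2) ltac:(lia) ltac:(lia).
have nE : (n - (n - n./2) = n./2)%N by lia.
rewrite nE in cl.
exists (k + l)%N; first by apply: controlled_cat ck cl; lia.
rewrite expnD (leq_trans (leq_mul hk hl))//.
have nn : n = (n./2 + (n - n./2))%N by lia.
by move: (n./2) (n - n./2)%N nn => p q ->; rewrite mulnACA; exact: (nat_AGM2 p q).1.
Qed.

End partition.

(** * The risk of the least squares fit *)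

(** [D2], [G1] and [G2] stand for [|g1 - g2|^2], [|g1|^2] and [|g2|^2].  As [|g1|]
    exceeds [|g2|] by at most the norm of the difference, that norm appears on the
    right only to the first power and is absorbed. *)
Lemma least_squares_absorb (R : realType) (D2 H G1 G2 B X : R) :
    0 <= D2 -> 0 <= H -> 0 <= G2 -> 0 <= X -> 0 <= B ->
    G1 <= 2 * G2 + 2 * D2 -> G2 <= B ^+ 2 ->
    D2 <= 2 * (Num.sqrt D2 * Num.sqrt H + X * (Num.sqrt G1 + Num.sqrt G2)) ->
  D2 <= 8 * H + 32 * X ^+ 2 + 12 * (X * B).
Proof.
move=> D0 H0 G20 X0 B0 hG1 hG2 hD.
set D := Num.sqrt D2 in hD; set h := Num.sqrt H in hD.
have D2E : D2 = D ^+ 2 by rewrite sqr_sqrtr.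
have HE : H = h ^+ 2 by rewrite sqr_sqrtr.
have Dp : 0 <= D by exact: sqrtr_ge0.
have g2 : Num.sqrt G2 <= B by rewrite -(ger0_norm B0) -sqrtr_sqr ler_wsqrtr.
have g1 : Num.sqrt G1 <= 2 * B + 2 * D.
  have BD : 0 <= 2 * B + 2 * D by apply: addr_ge0; exact: mulr_ge0.
  rewrite -(ger0_norm BD) -sqrtr_sqr ler_wsqrtr//; apply: (le_trans hG1).
  have BDp := mulr_ge0 B0 Dp.
  have := sqr_ge0 B; have := sqr_ge0 D; rewrite D2E; move: hG2.
  by nra.
have hX : X * (Num.sqrt G1 + Num.sqrt G2) <= X * (3 * B + 2 * D).
  apply: ler_wpM2l => //; move: g1 g2; lra.
rewrite D2E HE in hD *.
have e1 : 2 * (D * h) <= D ^+ 2 / 4 + 4 * h ^+ 2.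
  by have := sqr_ge0 (D / 2 - 2 * h); nra.
have e2 : 4 * (X * D) <= D ^+ 2 / 4 + 16 * X ^+ 2.
  by have := sqr_ge0 (D / 2 - 4 * X); nra.
move: hX; rewrite mulrDr; nra.
Qed.

Section risk.
Context d (T : measurableType d) (R : realType) (P : probability T R).
Variables (n : nat) (s M : R) (Z : nat -> T -> R) (t : nat -> R).
Variables (kappa alpha y : R).
Hypotheses (s0 : 0 < s) (kappa0 : 0 < kappa) (y0 : 0 < y).

(** [g1] and [g2] are the fitted and the true function minus an affine function
    close to the latter, whose distance to it is at most [B]. *)
Lemma controlled_risk k (B X c : R) (g1 : T -> nat -> R) (g2 : nat -> R) :
    X = k%:R * (24 * kappa * s / y ^+ 3) ->
    controlled P n s M Z t kappa alpha y 0 n k -> 0 <= B -> 0 <= c ->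
    (forall w, convex_seq n t (g1 w)) -> convex_seq n t g2 ->
    sumsq n g2 <= B ^+ 2 ->
    (forall w, \sum_(0 <= i < n) (g1 w i - g2 i) ^+ 2 <=
       2 * \sum_(0 <= i < n) Z i w * (g1 w i - g2 i)) ->
  (\int[P]_w (c * \sum_(0 <= i < n) (g1 w i - g2 i) ^+ 2)%:E <=
    (c * (8 * (k%:R * (4 * M * s ^+ 2 + alpha * s ^+ 2 * y ^+ 2)) +
      (32 * X ^+ 2 + 12 * (X * B))))%:E)%E.
Proof.
move=> XE [H mH hH] B0 c0 c1 c2 hg2 ls.
have X0 : 0 <= X.
  rewrite XE; apply: mulr_ge0 => //; apply: divr_ge0.
    by apply: mulr_ge0 (ltW s0); apply: mulr_ge0 (ltW kappa0).
  by apply: exprn_ge0; exact: ltW.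
have cst0 : 0 <= 32 * X ^+ 2 + 12 * (X * B).
  apply: addr_ge0; first by apply: mulr_ge0 => //; exact: sqr_ge0.
  by apply: mulr_ge0 => //; exact: mulr_ge0.
have [_ _ bound] := mean_leZ c0 (mean_leD (mean_leZ (ler0n R 8) mH) (mean_le_cst P cst0)).
apply: le_trans bound; apply: le_ge0_integral => w.
  by apply: mulr_ge0 => //; exact: (sum_sqr_ge0 (fun i => g1 w i - g2 i)).
apply: ler_wpM2l => //.
rewrite addrA; apply: (@least_squares_absorb _ _ _ (sumsq n (g1 w)) (sumsq n g2)) => //.
- exact: (sum_sqr_ge0 (fun i => g1 w i - g2 i)).
- by case: mH.
- exact: sum_sqr_ge0.
- rewrite /sumsq !mulr_sumr -big_split/=; apply: ler_sum => i _.
  by have := sqr_ge0 (2 * g2 i - g1 w i); nra.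
apply: (le_trans (ls w)); rewrite ler_pM2l//.
have := hH w (fun i => g1 w i - g2 i) (g1 w) g2 (fun=> erefl) (c1 w) c2.
by rewrite mul1r XE mulrA.
Qed.

End risk.

(** * Convex functions sampled at the design points *)

Section convex_functions.
Context (R : realType).

Lemma convex01_three_points (f : R -> R) (a b c : R) : convex01 f ->
    0 <= a -> a < b -> b < c -> c <= 1 ->
  (c - a) * f b <= (c - b) * f a + (b - a) * f c.
Proof.
move=> cf a0 ab bc c1.
have ca : 0 < c - a by lra.
have l0 : 0 <= (c - b) / (c - a) by rewrite divr_ge0//; lra.
have l1 : (c - b) / (c - a) <= 1 by rewrite ler_pdivrMr//; lra.
have : f ((c - b) / (c - a) * a + (1 - (c - b) / (c - a)) * c) <=
    (c - b) / (c - a) * f a + (1 - (c - b) / (c - a)) * f c.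
  by apply: (cf (Itv01 l0 l1) a c); rewrite inE/= in_itv/=; apply/andP; split; lra.
have -> : (c - b) / (c - a) * a + (1 - (c - b) / (c - a)) * c = b.
  by field; rewrite gt_eqF.
move=> /(ler_wpM2l (ltW ca)); congr (_ <= _).
by field; rewrite gt_eqF.
Qed.

(** Dilating the abscissae preserves convexity, and it brings the gaps between
    design points to unit order. *)
Lemma convex01_sub_affine_seq (n : nat) (f tau : R -> R) (x : nat -> R) (lam : R) :
    0 < lam -> convex01 f -> affine01 tau ->
    (forall i, (i < n)%N -> 0 <= x i <= 1) ->
    (forall i, (i.+1 < n)%N -> x i < x i.+1) ->
  convex_seq n (fun i => lam * x i) (fun i => f (x i) - tau (x i)).
Proof.
move=> lam0 cf [p [q tauE]] x01 xinc.
have step i : (i.+2 < n)%N ->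
    slope (fun i => lam * x i) (fun i => f (x i) - tau (x i)) i <=
    slope (fun i => lam * x i) (fun i => f (x i) - tau (x i)) i.+1.
  move=> i2.
  have i1 := ltnW i2; have i0 := ltnW i1.
  have u1 := xinc _ i1; have u2 := xinc _ i2.
  have /andP[a0 a1] := x01 _ i0; have /andP[b0 b1] := x01 _ i1.
  have /andP[c0 c1] := x01 _ i2.
  rewrite /slope !tauE ?in_itv/= ?a0 ?a1 ?b0 ?b1 ?c0 ?c1//.
  have := convex01_three_points cf a0 u1 u2 c1.
  move: (f (x i)) (f (x i.+1)) (f (x i.+2)) u1 u2.
  move: (x i) (x i.+1) (x i.+2) => a b c fa fb fc u1 u2 h.
  rewrite -!mulrBr ler_pdivrMr; last by rewrite mulr_gt0// subr_gt0.
  rewrite mulrAC ler_pdivlMr; last by rewrite mulr_gt0// subr_gt0.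
  move/(ler_wpM2l (ltW lam0)): h; lra.
move=> i j; elim: j => [|j IH]; first by rewrite leqn0 => /eqP->.
rewrite leq_eqVlt => /predU1P[->//|ij] jn.
by apply: le_trans (step j jn); apply: IH => //; exact: ltnW.
Qed.

End convex_functions.

(** * Logarithms and the choice of scale *)

Section numeric.
Context (R : realType).

Lemma expR1_ge2 : 2 <= expR 1 :> R.
Proof. by apply: le_trans (expR_ge1Dx 1); lra. Qed.

(** Since the design points lie in an interval of length 1, [c1] is at most
    [n / (n - 1)], so [L] is at least the logarithm of [e * (n - 1) / 2].  Hence
    it stays away from 0 and dominates [ln n], which bounds the number [k] of
    blocks given by [controlled_all]. *)
Lemma log_term_bounds (n : nat) (c1 L : R) : (2 <= n)%N -> 0 < c1 ->
    c1 * (n%:R - 1) <= n%:R -> L = ln (expR 1 * n%:R / (2 * c1)) ->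
  1 / 9 <= L /\ forall k, (2 ^ k <= n ^ 2)%N -> k%:R <= 40 * L.
Proof.
move=> n2 c10 c1n LE.
have n2R : 2 <= n%:R :> R by rewrite (ler_nat R 2).
have e0 : 0 < expR 1 :> R by exact: expR_gt0.
have n1 : 0 < n%:R - 1 :> R by lra.
have n0 : 0 < n%:R :> R by lra.
have arg_ge : expR 1 * (n%:R - 1) / 2 <= expR 1 * n%:R / (2 * c1).
  rewrite ler_pdivlMr ?mulr_gt0//.
  have -> : expR 1 * (n%:R - 1) / 2 * (2 * c1) = expR 1 * (c1 * (n%:R - 1)).
    by field.
  by rewrite ler_pM2l.
have arg0 : 0 < expR 1 * n%:R / (2 * c1) by rewrite divr_gt0 ?mulr_gt0.
have eL : expR 1 * (n%:R - 1) / 2 <= expR L by rewrite LE lnK// posrE.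
have L9 : 1 / 9 <= L.
  rewrite -ler_expR; apply: le_trans eL.
  have h1 : (13 / 9) ^+ 2 <= expR (8 / 9) :> R.
    have -> : 8 / 9 = (2%:R * (4 / 9)) :> R by field.
    have h0 : 13 / 9 <= expR (4 / 9) :> R.
      by apply: le_trans (expR_ge1Dx _); lra.
    by rewrite expRM_natl lerXn2r// nnegrE ?expR_ge0//; lra.
  have h2 : expR 1 = expR (1 / 9) * expR (8 / 9) :> R.
    by rewrite -expRD; congr expR; field.
  have e9 : 0 < expR (1 / 9) :> R by exact: expR_gt0.
  have h3 : 2 <= expR (8 / 9) :> R by apply: le_trans h1; lra.
  have h4 : expR (1 / 9) * 2 <= expR 1 :> R by rewrite h2 ler_pM2l.
  have : expR 1 * 1 <= expR 1 * (n%:R - 1) :> R by rewrite ler_pM2l//; lra.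
  lra.
split=> // k kn.
have nL : n%:R <= expR (10 * L).
  have -> : 10 * L = L + 9 * L by ring.
  rewrite expRD.
  have h5 : 2 <= expR (9 * L).
    apply: le_trans expR1_ge2 _; rewrite ler_expR; lra.
  have h6 : n%:R / 2 <= expR L.
    apply: le_trans eL; rewrite ler_pM2r ?invr_gt0//.
    have : 2 * (n%:R - 1) <= expR 1 * (n%:R - 1) :> R by rewrite ler_pM2r// expR1_ge2.
    lra.
  have : n%:R / 2 * 2 <= expR L * expR (9 * L) by apply: ler_pM => //; lra.
  lra.
have n2L : n%:R ^+ 2 <= expR (20 * L).
  have -> : 20 * L = 2%:R * (10 * L) by ring.
  by rewrite expRM_natl lerXn2r ?nnegrE ?expR_ge0// ltW.
have half : expR (1 / 2) <= 2 :> R.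
  have -> : 1 / 2 = - (- (1 / 2)) :> R by rewrite opprK.
  rewrite expRN -[leRHS]invrK lef_pV2 ?posrE ?invr_gt0 ?expR_gt0//.
  by apply: le_trans (expR_ge1Dx _); lra.
have : expR (k%:R * (1 / 2)) <= expR (20 * L).
  apply: le_trans n2L; rewrite expRM_natl.
  apply: (@le_trans _ _ (2 ^+ k)); first by rewrite lerXn2r ?nnegrE ?expR_ge0.
  by rewrite -!natrX ler_nat.
by rewrite ler_expR; lra.
Qed.

(** [y] is the tenth root of [n * r ^+ 2 / s ^+ 2]. *)
Lemma rate_parameter (n : nat) (s r L C : R) : (0 < n)%N -> 0 < s -> 1 <= r ->
    1 / 9 <= L -> 81 <= C -> C * L `^ (5 / 4) * (s ^+ 2 / r ^+ 2) <= n%:R ->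
  exists y, [/\ 1 <= y, L <= y ^+ 8, Num.sqrt n%:R * r = s * y ^+ 5 &
    s ^+ 2 * y ^+ 2 / n%:R = (s ^+ 2 * Num.sqrt r / n%:R) `^ (4 / 5)].
Proof.
move=> n0 s0 r1 L9 C81 hn.
have nR : 0 < n%:R :> R by rewrite ltr0n.
have r0 : 0 < r by lra.
have L0 : 0 <= L by lra.
pose z := n%:R * r ^+ 2 / s ^+ 2.
have z0 : 0 < z by rewrite divr_gt0 ?mulr_gt0 ?exprn_gt0.
have zge : C * L `^ (5 / 4) <= z.
  rewrite /z ler_pdivlMr ?exprn_gt0//.
  have := ler_wpM2r (ltW (exprn_gt0 2 r0)) hn.
  by congr (_ <= _); field; rewrite gt_eqF.
have one : 1 <= 81 * L `^ (5 / 4).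
  have h1 : 1 <= (9 * L) `^ (5 / 4).
    have h9 : 1 <= 9 * L by lra.
    by apply: (le_trans h9); apply: le1r_powR => //; lra.
  apply: (le_trans h1); rewrite powRM//.
  apply: ler_wpM2r; first exact: powR_ge0.
  have -> : 81 = 9 `^ 2%:R :> R by rewrite powR_mulrn//; ring.
  by apply: ler_powR; lra.
have P0 : 0 <= L `^ (5 / 4) by exact: powR_ge0.
have z1 : 1 <= z.
  by apply: (le_trans one); apply: le_trans zge; apply: ler_wpM2r.
pose y := z `^ (1 / 10).
have y1 : 1 <= y.
  rewrite -(powRr0 z) /y; apply: ler_powR => //; lra.
have y0 : 0 < y by lra.
have yX k : y ^+ k = z `^ (k%:R / 10).
  rewrite -powR_mulrn ?(ltW y0)// /y -powRrM; congr (_ `^ _).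
  by rewrite mulrC mul1r.
have y10 : y ^+ 10 = z.
  by rewrite yX divff ?powRr1// ?(ltW z0)// pnatr_eq0.
exists y; split => //.
- have Lz : L `^ (5 / 4) <= z.
    apply: le_trans zge; rewrite ler_peMl//; lra.
  have -> : L = (L `^ (5 / 4)) `^ (4 / 5).
    by rewrite -powRrM (_ : 5 / 4 * (4 / 5) = 1) ?powRr1//; field.
  have -> : y ^+ 8 = z `^ (4 / 5) by rewrite yX; congr (_ `^ _); field.
  by apply: ge0_ler_powR => //; rewrite ?nnegrE ?(ltW z0)//; lra.
- have a0 : 0 <= Num.sqrt n%:R * r by rewrite mulr_ge0 ?sqrtr_ge0 ?ltW.
  have b0 : 0 <= s * y ^+ 5 by rewrite mulr_ge0 ?exprn_ge0 ?ltW.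
  apply/eqP; rewrite -(@eqrXn2 _ 2)//; apply/eqP.
  have -> : (s * y ^+ 5) ^+ 2 = s ^+ 2 * y ^+ 10 by ring.
  have -> : (Num.sqrt n%:R * r) ^+ 2 = n%:R * r ^+ 2.
    by rewrite exprMn sqr_sqrtr// ltW.
  rewrite y10 /z.
  by field; rewrite gt_eqF.
set q := s ^+ 2 * Num.sqrt r / n%:R.
have q0 : 0 <= q.
  by rewrite /q divr_ge0 ?(ltW nR)// mulr_ge0 ?sqr_ge0 ?sqrtr_ge0.
apply/eqP; rewrite -(@eqrXn2 _ 5)//; last 2 first.
- by rewrite divr_ge0 ?(ltW nR)// mulr_ge0 ?sqr_ge0.
- exact: powR_ge0.
rewrite -[X in _ == X]powR_mulrn ?powR_ge0// -powRrM.
rewrite (_ : 4 / 5 * 5%:R = 4%:R); last by field.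
rewrite powR_mulrn// /q.
have -> : (s ^+ 2 * y ^+ 2 / n%:R) ^+ 5 = s ^+ 10 * y ^+ 10 / n%:R ^+ 5.
  by rewrite expr_div_n; congr (_ / _); ring.
have -> : (s ^+ 2 * Num.sqrt r / n%:R) ^+ 4 = s ^+ 8 * Num.sqrt r ^+ 4 / n%:R ^+ 4.
  by rewrite expr_div_n; congr (_ / _); ring.
rewrite y10 /z.
have r2 : Num.sqrt r ^+ 4 = r ^+ 2.
  by rewrite (exprM (Num.sqrt r) 2 2) sqr_sqrtr// ltW.
rewrite r2; apply/eqP; field.
by rewrite !gt_eqF.
Qed.

(** With [B] of order [s * y ^+ 5] the main term and the term [X * B] are both of
    order [k * s ^+ 2 * y ^+ 2].  The absorption costs [X ^+ 2], of order
    [k ^+ 2 * s ^+ 2 / y ^+ 6], which is of the same order because [k] is at most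
    a multiple of [y ^+ 8]. *)
Lemma final_arithmetic (s y kappa M alpha L k B A X : R) : 0 < s -> 1 <= y ->
    0 < kappa -> 0 <= M -> 0 <= alpha -> 0 <= k -> k <= A * L -> 0 <= A -> L <= y ^+ 8 ->
    X = k * (24 * kappa * s / y ^+ 3) -> B = 2 * (s * y ^+ 5) ->
  8 * (k * (4 * M * s ^+ 2 + alpha * s ^+ 2 * y ^+ 2)) +
     (32 * X ^+ 2 + 12 * (X * B)) <=
  A * (8 * (4 * M + alpha) + 32 * (24 * 24) * kappa ^+ 2 * A + 12 * (24 * 2) * kappa) * L *
    (s ^+ 2 * y ^+ 2).
Proof.
move=> s0 y1 k0 M0 a0 kk kA A0 Ly XE BE.
have y0 : 0 < y by lra.
have XB : 12 * (X * B) = k * (12 * (24 * 2) * kappa * (s ^+ 2 * y ^+ 2)).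
  by rewrite XE BE; field; rewrite gt_eqF.
have y8 : k <= A * y ^+ 8 by apply: (le_trans kA); apply: ler_wpM2l.
have XX : 32 * X ^+ 2 <= k * (32 * (24 * 24) * kappa ^+ 2 * A * (s ^+ 2 * y ^+ 2)).
  have -> : 32 * X ^+ 2 =
      k * (32 * (24 * 24) * kappa ^+ 2 * (k / y ^+ 8) * (s ^+ 2 * y ^+ 2)).
    by rewrite XE; field; rewrite gt_eqF.
  apply: ler_wpM2l => //; apply: ler_wpM2r.
    by apply: mulr_ge0; exact: sqr_ge0.
  apply: ler_wpM2l; first by apply: mulr_ge0; [do 2 apply: mulr_ge0 => //|exact: sqr_ge0].
  by rewrite ler_pdivrMr// exprn_gt0.
have S0 : 0 <= s ^+ 2 * y ^+ 2 by apply: mulr_ge0; exact: sqr_ge0.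
have y2 : s ^+ 2 <= s ^+ 2 * y ^+ 2.
  by rewrite ler_peMr ?sqr_ge0// exprn_ege1.
have XA : 8 * (k * (4 * M * s ^+ 2 + alpha * s ^+ 2 * y ^+ 2)) <=
    k * (8 * (4 * M + alpha) * (s ^+ 2 * y ^+ 2)).
  have : k * (4 * M) * s ^+ 2 <= k * (4 * M) * (s ^+ 2 * y ^+ 2).
    by apply: ler_wpM2l => //; apply: mulr_ge0 => //; exact: mulr_ge0.
  lra.
set Q := 8 * (4 * M + alpha) + 32 * (24 * 24) * kappa ^+ 2 * A + 12 * (24 * 2) * kappa.
have Q0 : 0 <= Q.
  have M4 : 0 <= 4 * M by apply: mulr_ge0.
  apply: addr_ge0; [apply: addr_ge0|].
  - by apply: mulr_ge0 => //; exact: addr_ge0.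
  - apply: mulr_ge0 A0; apply: mulr_ge0 (sqr_ge0 _).
    by apply: mulr_ge0 => //; exact: mulr_ge0.
  - by apply: mulr_ge0 (ltW k0); apply: mulr_ge0 => //; exact: mulr_ge0.
apply: (@le_trans _ _ (k * (Q * (s ^+ 2 * y ^+ 2)))).
  rewrite /Q (mulrDl _ (12 * (24 * 2) * kappa)) (mulrDl (8 * (4 * M + alpha))).
  rewrite (mulrDr k _ (12 * (24 * 2) * kappa * _)) (mulrDr k (8 * (4 * M + alpha) * _)).
  by rewrite XB addrA lerD2r; exact: lerD.
have -> : A * Q * L * (s ^+ 2 * y ^+ 2) = A * L * (Q * (s ^+ 2 * y ^+ 2)) by ring.
by apply: ler_wpM2r => //; exact: mulr_ge0.
Qed.

End numeric.

(** * The risk bound *)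

Theorem theorem2p2 (R : realType) (ratio : R) (ratio_gt0 : 0 < ratio) :
  exists2 C : R, 0 < C &
  forall (c1 c2 : R) (n : nat) (x : 'I_n -> R) (phi0 : R -> R) (sigma : R)
      (d : measure_display) (T : measurableType d) (P : probability T R)
      (xi : 'I_n -> {RV P >-> R}) (phihat : T -> R -> R),
    0 < c1 -> 0 < c2 -> c1 / c2 = ratio ->
    (2 <= n)%N ->
    design_points c1 c2 x ->
    convex01 phi0 ->
    0 < sigma ->
    mutually_independent xi ->
    (forall i, normally_distributed (xi i) 0 sigma) ->
    (forall w : T,
      is_convex_lse x (fun i => phi0 (x i) + xi i w) (phihat w)) ->
    let r := Num.max 1 (affine_dist x phi0) in
    let log_term := ln (expR 1 * n%:R / (2 * c1)) in
    C * log_term `^ (5 / 4) * (sigma ^+ 2 / r ^+ 2) <= n%:R ->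
    ('E_P[fun w => sq_loss x (phihat w) phi0] <=
      (C * log_term * (sigma ^+ 2 * Num.sqrt r / n%:R) `^ (4 / 5))%:E)%E.

pose M : R := 512 * expR 1.
pose alpha : R := 36 * (72 * M).
pose kappa := ratio^-1.
pose Q := 8 * (4 * M + alpha) + 32 * (24 * 24) * kappa ^+ 2 * 40 + 12 * (24 * 2) * kappa.
have M1 : 1 <= M.
  have := expR1_ge2 R; rewrite /M; lra.
have M0 : 0 <= M by exact: le_trans ler01 M1.
have alpha0 : 0 <= alpha by apply: mulr_ge0 => //; exact: mulr_ge0.
have kappa0 : 0 < kappa by rewrite invr_gt0.
have Q0 : 0 <= Q.
  have M4 : 0 <= 4 * M by apply: mulr_ge0.
  apply: addr_ge0; [apply: addr_ge0|].
  - by apply: mulr_ge0 => //; exact: addr_ge0.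
  - apply: mulr_ge0 => //; apply: mulr_ge0 (sqr_ge0 _).
    by apply: mulr_ge0 => //; exact: mulr_ge0.
  - by apply: mulr_ge0 (ltW kappa0); apply: mulr_ge0 => //; exact: mulr_ge0.
have C0 : 0 <= 40 * Q by apply: mulr_ge0.
exists (40 * Q + 81); first by apply: ltr_wpDl.
move=> c1 c2 [|[|m]] // x phi0 s d T P xi phihat c10 c20 c12 _ [x01 xinc xgap]
  cphi0 s0 ind nor lse.
set N := m.+2 in x xi x01 xinc xgap ind nor lse *.
move=> r L hn.
have NR : 0 < N%:R :> R by rewrite ltr0n.
pose xs i := x (inord i : 'I_N).
have ordE i : (i < N)%N -> (inord i : 'I_N) = i :> nat by move=> iN; rewrite inordK.
have gap i : (i.+1 < N)%N -> c1 <= N%:R * (xs i.+1 - xs i) <= c2.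
  by move=> iN; apply: xgap; rewrite !ordE// ltnW.
have xs01 i : 0 <= xs i <= 1 by exact: x01.
have xsinc i : (i.+1 < N)%N -> xs i < xs i.+1.
  by move=> iN; apply: xinc; rewrite !ordE// ltnW.
have spread i : (i < N)%N -> c1 * i%:R <= N%:R * (xs i - xs 0%N).
  elim: i => [_|i IH iN]; first by rewrite subrr !mulr0.
  have /andP[h _] := gap i iN; have := IH (ltnW iN).
  rewrite -natr1 => h'; move: h h'; rewrite !mulrDr; lra.
have c1N : c1 * (N%:R - 1) <= N%:R.
  have := spread m.+1 (ltnSn _); have /andP[_ h1] := xs01 m.+1; have /andP[h0 _] := xs01 0%N.
  have -> : N%:R - 1 = m.+1%:R :> R by rewrite /N -natr1 addrK.
  move=> h; apply: (le_trans h); rewrite -[leRHS]mulr1 ler_pM2l//; lra.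
have [L9 kL] := log_term_bounds (isT : (2 <= N)%N) c10 c1N (erefl : L = _).
have r1 : 1 <= r by rewrite /r le_max lexx.
have C81 : 81 <= 40 * Q + 81 by rewrite lerDr.
have [y [y1 Ly yr yq]] := rate_parameter (isT : (0 < N)%N) s0 r1 L9 C81 hn.
pose lam := N%:R / c1.
have lam0 : 0 < lam by rewrite divr_gt0.
have tgap i : (i.+1 < N)%N -> 1 <= lam * xs i.+1 - lam * xs i <= kappa.
  move=> /gap /andP[h1 h2].
  have -> : lam * xs i.+1 - lam * xs i = N%:R * (xs i.+1 - xs i) / c1.
    by rewrite /lam; field; rewrite gt_eqF.
  rewrite ler_pdivlMr// mul1r h1 ler_pdivrMr//=.
  apply: (le_trans h2); rewrite /kappa -c12 le_eqVlt; apply/orP; left; apply/eqP.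
  by field; rewrite !gt_eqF.
have hZ := normal_lform_moment4 s0 ind nor.
have [k ck kn] := controlled_all s0 M1 hZ kappa0 (lexx alpha) y1 tgap isT.
(* The infimum defining [affine_dist] is below [2 * r] because [r] is positive. *)
have [_ [tau atau <-] ltau] : exists2 l, [set loss x phi0 tau | tau in [set tau | affine01 tau]] l & l < 2 * r.
  apply: inf_lt.
    exists (loss x phi0 (fun=> 0)), (fun=> 0) => //=.
    by exists 0, 0 => t _; rewrite mul0r addr0.
  have : affine_dist x phi0 <= r by rewrite /r le_max lexx orbT.
  rewrite /affine_dist; lra.
have sumE (F : R -> R) : \sum_(i < N) F (x i) = \sum_(0 <= i < N) F (xs i).
  by rewrite big_mkord; apply: eq_bigr => i _; rewrite /xs inord_val.
pose g1 w i := phihat w (xs i) - tau (xs i).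
pose g2 i := phi0 (xs i) - tau (xs i).
pose B := 2 * (s * y ^+ 5).
have B0 : 0 <= B.
  by apply: mulr_ge0 => //; apply: mulr_ge0 (ltW s0) _; rewrite exprn_ge0//; lra.
have hB : sumsq N g2 <= B ^+ 2.
  rewrite /B -yr.
  have S0 : 0 <= sumsq N g2 by exact: sum_sqr_ge0.
  have : Num.sqrt (N%:R^-1 * sumsq N g2) < 2 * r.
    by move: ltau; rewrite /loss /sq_loss (sumE (fun u => (phi0 u - tau u) ^+ 2)).
  move=> /ltW; rewrite -[leRHS]ger0_norm; last lra.
  rewrite -sqrtr_sqr ler_sqrt ?sqr_ge0// ler_pdivrMl//.
  rewrite !exprMn sqr_sqrtr ?(ltW NR)//; lra.
have cg1 w : convex_seq N (fun i => lam * xs i) (g1 w).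
  by apply: convex01_sub_affine_seq => //; case: (lse w).
have cg2 : convex_seq N (fun i => lam * xs i) g2.
  exact: convex01_sub_affine_seq.
have gE w i : g1 w i - g2 i = phihat w (xs i) - phi0 (xs i) by rewrite /g1 /g2; ring.
(* The true function competes with the fitted one. *)
have ls w : \sum_(0 <= i < N) (g1 w i - g2 i) ^+ 2 <=
    2 * \sum_(0 <= i < N) xi (inord i) w * (g1 w i - g2 i).
  have [_ /(_ phi0 cphi0)] := lse w.
  rewrite -subr_ge0 -sumrB => h.
  rewrite -subr_ge0; move: h; congr (_ <= _).
  rewrite !big_mkord mulr_sumr -sumrB; apply: eq_bigr => i _.
  by rewrite gE /xs inord_val; ring.
have N0 : 0 <= N%:R^-1 :> R by rewrite invr_ge0.
have := controlled_risk s0 kappa0 (lt_le_trans ltr01 y1) erefl ck B0 N0 cg1 cg2 hB ls.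
move=> h; rewrite unlock.
under eq_integral do rewrite /sq_loss (sumE (fun u => (phihat _ u - phi0 u) ^+ 2)).
under eq_integral do under eq_bigr do rewrite -gE.
apply: (le_trans h); rewrite lee_fin -yq mulrC.
have n40 := kL k kn.
have := final_arithmetic s0 y1 kappa0 M0 alpha0 (ler0n R k) n40 (ler0n R 40) Ly erefl (erefl B).
move=> /(ler_wpM2r N0) h2; apply: (le_trans h2).
have -> : (40 * Q + 81) * L * (s ^+ 2 * y ^+ 2 / N%:R) =
   (40 * Q + 81) * (L * (s ^+ 2 * y ^+ 2)  / N%:R) by ring.
have -> : 40 * Q * L * (s ^+ 2 * y ^+ 2) / N%:R = 40 * Q * (L * (s ^+ 2 * y ^+ 2) / N%:R).
  by ring.
apply: ler_wpM2r; last by rewrite lerDl.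
apply: mulr_ge0 => //; apply: mulr_ge0; first lra.
by apply: mulr_ge0; exact: sqr_ge0.
Qed.
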